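(* Let $G$ be a finite group, and let $X$ and $X'$ be $\mathbb{Z}$-free $G$-modules. Given a positive integer $r$, the pair $(X,X')$ is an $r$-encoding pair if and only if there is an exact sequence of $G$-modules $$0\to X\to P_r\to P_{r-1}\to\cdots\to P_2\to P_1\to X'\to 0,$$ where each $P_i$ is $\mathbb{Z}[G]$-projective.
   Context: $\widehat H^\bullet(G,-)$ denotes Tate cohomology. A $G$-module is a $\mathbb{Z}[G]$-module; $\operatorname{Hom}_{\mathbb{Z}}(X,A)$ carries the action $(gf)(x)=g\,f(g^{-1}x)$. $\mathbb{Z}$-free means free as an abelian group. Definition. For $r\in\mathbb{Z}$, a pair of $G$-modules $(X,X')$ is an $r$-encoding pair if there is a natural isomorphism of functors (from $G$-modules to abelian groups) $\widehat H^i(G,\operatorname{Hom}_{\mathbb{Z}}(X,-))\simeq\widehat H^{i+r}(G,\operatorname{Hom}_{\mathbb{Z}}(X',-))$ for some $i\in\mathbb{Z}$. *)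

(* Defs.v *)
From HB Require Import structures.
From mathcomp Require Import all_boot all_order all_algebra all_fingroup.
From mathcomp Require Import generic_quotient ring_quotient.
From mathcomp Require Import zify boolp.

Set Implicit Arguments.
Unset Strict Implicit.
Unset Printing Implicit Defensive.

Import GRing.Theory.
Local Open Scope ring_scope.
Local Open Scope quotient_scope.

(** * The group ring Z[G] and G-modules *)

(* The element a stands for the formal sum of the (a g) g over g in G. *)
Definition groupring (G : finGroupType) := {ffun G -> int}.

Section GroupRing.
Variable G : finGroupType.
Local Notation ZG := (groupring G).

HB.instance Definition _ := GRing.Zmodule.on ZG.

Definition gbase (g : G) : ZG := [ffun h => (h == g)%:R].

Definition gr_one : ZG := gbase 1%g.

Definition gr_mul (a b : ZG) : ZG :=
  [ffun x => \sum_(y : G) a y * b (y^-1 * x)%g].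

Lemma gr_mulA : associative gr_mul.
Proof.
move=> a b c; apply/ffunP => x; rewrite !ffunE.
under eq_bigr do rewrite ffunE mulr_sumr.
under [RHS]eq_bigr do rewrite ffunE mulr_suml.
rewrite [RHS]exchange_big /=; apply: eq_bigr => y _.
rewrite [RHS](reindex_inj (mulgI y)) /=; apply: eq_bigr => z _.
by rewrite mulKg invMg mulrA mulgA.
Qed.

Lemma gr_mul1l : left_id gr_one gr_mul.
Proof.
move=> a; apply/ffunP => x; rewrite ffunE (bigD1 1%g) //= ffunE eqxx.
rewrite invg1 mul1g mul1r big1 ?addr0 // => y yn1.
by rewrite ffunE (negbTE yn1) mul0r.
Qed.

Lemma gr_mul1r : right_id gr_one gr_mul.
Proof.
move=> a; apply/ffunP => x; rewrite ffunE (bigD1 x) //= ffunE mulVg eqxx mulr1.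
rewrite big1 ?addr0 // => y ynx.
by rewrite ffunE -eq_mulVg1 (negbTE ynx) mulr0.
Qed.

Lemma gr_mulDl : left_distributive gr_mul +%R.
Proof.
move=> a b c; apply/ffunP => x; rewrite !ffunE -big_split /=.
by apply: eq_bigr => y _; rewrite ffunE mulrDl.
Qed.

Lemma gr_mulDr : right_distributive gr_mul +%R.
Proof.
move=> a b c; apply/ffunP => x; rewrite !ffunE -big_split /=.
by apply: eq_bigr => y _; rewrite ffunE mulrDr.
Qed.

Lemma gr_one_neq0 : gr_one != 0.
Proof. by apply/eqP => /ffunP/(_ 1%g); rewrite !ffunE eqxx. Qed.

HB.instance Definition _ := GRing.Zmodule_isNzRing.Build ZG
  gr_mulA gr_mul1l gr_mul1r gr_mulDl gr_mulDr gr_one_neq0.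

Lemma gbase1 : gbase 1%g = 1. Proof. by []. Qed.

Lemma gbaseM g h : gbase (g * h)%g = gbase g * gbase h.
Proof.
apply/ffunP => x; rewrite !ffunE (bigD1 g) //= !ffunE eqxx mul1r.
rewrite big1 => [|y yng]; last by rewrite ffunE (negbTE yng) mul0r.
by rewrite addr0 -[in RHS](inj_eq (mulgI g)) mulKVg.
Qed.

Lemma groupringE (a : ZG) : a = \sum_(g : G) gbase g *~ a g.
Proof.
have E (h g : G) : (gbase h *~ a h) g = (g == h)%:R * a h.
  have ffunMz (b : ZG) (n : int) : (b *~ n) g = b g *~ n.
    have ffunMn (m : nat) : (b *+ m) g = b g *+ m.
      by elim: m => [|m IH]; rewrite ?mulr0n ?ffunE // !mulrS ffunE IH.
    by case: n => n; rewrite ?NegzE ?mulrNz -?pmulrn ?ffunE ffunMn.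
  by rewrite ffunMz ffunE -mulrzr intz.
apply/ffunP => g; rewrite sum_ffunE (bigD1 g) //= E eqxx mul1r big1 ?addr0 //.
by move=> h hng; rewrite E eq_sym (negbTE hng) mul0r.
Qed.

End GroupRing.

Notation gmodType G := (lmodType (groupring G)).

Section GroupAction.
Variables (G : finGroupType) (M : gmodType G).

Definition gscale (g : G) (x : M) : M := gbase g *: x.

Lemma gscale1 x : gscale 1%g x = x.
Proof. by rewrite /gscale gbase1 scale1r. Qed.

Lemma gscaleM g h x : gscale (g * h)%g x = gscale g (gscale h x).
Proof. by rewrite /gscale gbaseM scalerA. Qed.

Lemma gscale_is_zmod_morphism g : zmod_morphism (gscale g).
Proof. by move=> x y; rewrite /gscale scalerBr. Qed.

HB.instance Definition _ g :=
  GRing.isZmodMorphism.Build M M (gscale g) (gscale_is_zmod_morphism g).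

Lemma scaler_gscale (a : groupring G) x :
  a *: x = \sum_(g : G) gscale g x *~ a g.
Proof.
rewrite {1}(groupringE a) scaler_suml; apply: eq_bigr => g _.
by rewrite -scalerMzl.
Qed.

End GroupAction.

Lemma linear_gscale (G : finGroupType) (M N : gmodType G) (f : {linear M -> N})
  g x : f (gscale g x) = gscale g (f x).
Proof. exact: linearZ. Qed.

(* An abelian group with an additive left action of G is a Z[G]-module. *)
HB.factory Record Zmodule_isGModule (G : finGroupType) M
    of GRing.Zmodule M := {
  gmod_act : G -> M -> M;
  gmod_act_zmod : forall g, zmod_morphism (gmod_act g);
  gmod_act1 : forall x, gmod_act 1%g x = x;
  gmod_actM : forall g h x, gmod_act (g * h)%g x = gmod_act g (gmod_act h x)
}.

HB.builders Context G M of Zmodule_isGModule G M.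

Definition act_scale (a : groupring G) (x : M) : M :=
  \sum_(g : G) gmod_act g x *~ a g.

Let actA g : {additive M -> M} :=
  HB.pack (gmod_act g)
    (GRing.isZmodMorphism.Build M M (gmod_act g) (gmod_act_zmod g)).

Let act_mulrz g x n : gmod_act g (x *~ n) = gmod_act g x *~ n.
Proof. exact: (raddfMz (actA g)). Qed.

Let act_sum g (I : finType) (F : I -> M) :
  gmod_act g (\sum_i F i) = \sum_i gmod_act g (F i).
Proof. exact: (raddf_sum (actA g)). Qed.

Let actD g : {morph gmod_act g : x y / x + y}.
Proof. exact: (raddfD (actA g)). Qed.

Lemma act_scaleA a b x : act_scale a (act_scale b x) = act_scale (a * b) x.
Proof.
rewrite /act_scale; under [RHS]eq_bigr do rewrite ffunE mulrz_sumr.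
rewrite [RHS]exchange_big /=; apply: eq_bigr => g _.
rewrite act_sum mulrz_suml.
rewrite [RHS](reindex_inj (mulgI g)) /=; apply: eq_bigr => h _.
by rewrite mulKg gmod_actM act_mulrz -mulrzA mulrC.
Qed.

Lemma act_scale1 : left_id 1 act_scale.
Proof.
move=> x; rewrite /act_scale (bigD1 1%g) //= ffunE eqxx mulr1z gmod_act1.
by rewrite big1 ?addr0 // => g gn1; rewrite ffunE (negbTE gn1) mulr0z.
Qed.

Lemma act_scaleDr : right_distributive act_scale +%R.
Proof.
move=> a x y; rewrite /act_scale -big_split /=; apply: eq_bigr => g _.
by rewrite actD mulrzDl.
Qed.

Lemma act_scaleDl x : {morph act_scale^~ x : a b / a + b}.
Proof.
move=> a b; rewrite /act_scale -big_split /=; apply: eq_bigr => g _.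
by rewrite ffunE mulrzDr.
Qed.

HB.instance Definition _ := GRing.Zmodule_isLmodule.Build (groupring G) M
  act_scaleA act_scale1 act_scaleDr act_scaleDl.

HB.end.

(** * The G-module Hom_Z(X, A) *)

Definition homZ (G : finGroupType) (X A : gmodType G) := {additive X -> A}.

Section HomZ.
Variables (G : finGroupType) (X A : gmodType G).
Local Notation H := (homZ X A).

HB.instance Definition _ := gen_eqMixin H.
HB.instance Definition _ := gen_choiceMixin H.

Lemma homZ_ext (f g : H) : (f : X -> A) =1 g -> f = g.
Proof.
case: f => f [[cf]]; case: g => g [[cg]] /= /funext fg.
by subst g; rewrite (Prop_irrelevance cf cg).
Qed.

Definition homZ_zero : H := \0 : {additive X -> A}.
Definition homZ_opp (f : H) : H := \- f : {additive X -> A}.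
Definition homZ_add (f g : H) : H := f \+ g : {additive X -> A}.

Lemma homZ_addA : associative homZ_add.
Proof. by move=> f g h; apply: homZ_ext => x /=; rewrite addrA. Qed.

Lemma homZ_addC : commutative homZ_add.
Proof. by move=> f g; apply: homZ_ext => x /=; rewrite addrC. Qed.

Lemma homZ_add0 : left_id homZ_zero homZ_add.
Proof. by move=> f; apply: homZ_ext => x /=; rewrite add0r. Qed.

Lemma homZ_addN : left_inverse homZ_zero homZ_opp homZ_add.
Proof. by move=> f; apply: homZ_ext => x /=; rewrite addNr. Qed.

HB.instance Definition _ :=
  GRing.isZmodule.Build H homZ_addA homZ_addC homZ_add0 homZ_addN.

Definition homZ_act (g : G) (f : H) : H :=
  (gscale g \o f \o gscale g^-1%g : {additive X -> A}).

Lemma homZ_actE g f x : homZ_act g f x = gscale g (f (gscale g^-1%g x)).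
Proof. by []. Qed.

Lemma homZ_act_zmod g : zmod_morphism (homZ_act g).
Proof. by move=> f h; apply: homZ_ext => x /=; rewrite raddfB. Qed.

Lemma homZ_act1 f : homZ_act 1%g f = f.
Proof. by apply: homZ_ext => x /=; rewrite invg1 !gscale1. Qed.

Lemma homZ_actM g h f : homZ_act (g * h)%g f = homZ_act g (homZ_act h f).
Proof. by apply: homZ_ext => x /=; rewrite invMg !gscaleM. Qed.

HB.instance Definition _ :=
  Zmodule_isGModule.Build G H homZ_act_zmod homZ_act1 homZ_actM.

Lemma gscale_homZ g (f : H) : gscale g f = homZ_act g f.
Proof.
rewrite [LHS](bigD1 g) //= ffunE eqxx mulr1z big1 ?addr0 // => h hng.
by rewrite ffunE (negbTE hng) mulr0z.
Qed.

End HomZ.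

Section HomZMap.
Variables (G : finGroupType) (X A B : gmodType G) (u : {linear A -> B}).

Definition homZ_map (f : homZ X A) : homZ X B := (u \o f : {additive X -> B}).

Lemma homZ_map_is_linear : linear homZ_map.
Proof.
have mD : zmod_morphism homZ_map.
  by move=> f g; apply: homZ_ext => x /=; rewrite raddfB.
pose mA : {additive homZ X A -> homZ X B} :=
  HB.pack homZ_map (GRing.isZmodMorphism.Build _ _ homZ_map mD).
move=> a f g; rewrite -[homZ_map (a *: f + g)]/(mA _) raddfD; congr (_ + _).
rewrite !scaler_gscale raddf_sum; apply: eq_bigr => h _; rewrite raddfMz.
congr (_ *~ _); rewrite !gscale_homZ; apply: homZ_ext => x /=.
by rewrite linear_gscale.
Qed.

HB.instance Definition _ :=
  GRing.isLinear.Build _ _ _ _ homZ_map homZ_map_is_linear.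

End HomZMap.

(** * Tate cohomology *)

(* H^i(G, A) is computed by the complete standard resolution (P_i), for which
   Hom_G(P_i, A) is the group of equivariant functions from G^(i+1) to A if
   i >= 0, and from G^(-i) to A if i < 0 (P_(-q) is the dual of P_(q-1)).
   In int, i < 0 is Negz n with -i = n.+1, so both cases give n.+1. *)
Definition tate_width (i : int) : nat :=
  match i with Posz n => n.+1 | Negz n => n.+1 end.

(* The functions i + 1 and i - 1, defined so that they compute. *)
Definition int_succ (i : int) : int :=
  match i with
  | Posz n => Posz n.+1
  | Negz 0 => Posz 0
  | Negz n.+1 => Negz n
  end.

Definition int_pred (i : int) : int :=
  match i with
  | Posz 0 => Negz 0
  | Posz n.+1 => Posz n
  | Negz n => Negz n.+1
  end.

Lemma int_succE i : int_succ i = i + 1.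
Proof. by case: i => [n|[|n]] //=; lia. Qed.

Lemma int_predE i : int_pred i = i - 1.
Proof. by case: i => [[|n]|n] //=; lia. Qed.

Section Cochains.
Variables (G : finGroupType) (A : gmodType G).
Local Notation fn n := {ffun n.-tuple G -> A}.

Definition equivariant n (f : fn n) : bool :=
  [forall s : G, forall t : n.-tuple G,
     f [tuple of map (mulg s) t] == gscale s (f t)].

Definition tuple_del n (i : 'I_n.+1) (t : n.+1.-tuple G) : n.-tuple G :=
  [tuple tnth t (lift i j) | j < n].

Definition tuple_ins n (i : 'I_n.+1) (s : G) (t : n.-tuple G) : n.+1.-tuple G :=
  [tuple if unlift i j is Some k then tnth t k else s | j < n.+1].

(* diff_pos has degrees n -> n + 1, diff_norm has degrees -1 -> 0, and diff_neg
   has degrees -(n + 2) -> -(n + 1). On the dual basis of P_(-q) the boundary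
   sums over all ways of inserting one more group element. *)
Definition diff_pos n (f : fn n.+1) : fn n.+2 :=
  [ffun t => \sum_(i < n.+2) f (tuple_del i t) *~ (-1) ^+ i].

Definition diff_norm (f : fn 1) : fn 1 :=
  [ffun t => \sum_(s : G) f [tuple s]].

Definition diff_neg n (f : fn n.+2) : fn n.+1 :=
  [ffun t => \sum_(s : G) \sum_(i < n.+2) f (tuple_ins i s t) *~ (-1) ^+ i].

(* The differentials C^i -> C^(i+1) and C^(i-1) -> C^i. *)
Definition diff_out (i : int) :
    fn (tate_width i) -> fn (tate_width (int_succ i)) :=
  match i with
  | Posz n => @diff_pos n
  | Negz 0 => diff_norm
  | Negz n.+1 => @diff_neg n
  end.

Definition diff_in (i : int) :
    fn (tate_width (int_pred i)) -> fn (tate_width i) :=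
  match i with
  | Posz 0 => diff_norm
  | Posz n.+1 => @diff_pos n
  | Negz n => @diff_neg n
  end.

Lemma diff_pos_zmod n : zmod_morphism (@diff_pos n).
Proof.
move=> f g; apply/ffunP => t; rewrite !ffunE -sumrB.
by apply: eq_bigr => i _; rewrite !ffunE mulrzBl.
Qed.

Lemma diff_norm_zmod : zmod_morphism diff_norm.
Proof.
move=> f g; apply/ffunP => t; rewrite !ffunE -sumrB.
by apply: eq_bigr => i _; rewrite !ffunE.
Qed.

Lemma diff_neg_zmod n : zmod_morphism (@diff_neg n).
Proof.
move=> f g; apply/ffunP => t; rewrite !ffunE -sumrB.
apply: eq_bigr => s _; rewrite -sumrB.
by apply: eq_bigr => i _; rewrite !ffunE mulrzBl.
Qed.

Lemma diff_out_zmod i : zmod_morphism (@diff_out i).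
Proof.
case: i => [n|[|n]]; [exact: diff_pos_zmod|exact: diff_norm_zmod|].
exact: diff_neg_zmod.
Qed.

Lemma diff_in_zmod i : zmod_morphism (@diff_in i).
Proof.
case: i => [[|n]|n]; [exact: diff_norm_zmod|exact: diff_pos_zmod|].
exact: diff_neg_zmod.
Qed.

HB.instance Definition _ i :=
  GRing.isZmodMorphism.Build _ _ (@diff_out i) (@diff_out_zmod i).
HB.instance Definition _ i :=
  GRing.isZmodMorphism.Build _ _ (@diff_in i) (@diff_in_zmod i).

Lemma equivariantP n (f : fn n) :
  reflect (forall (s : G) (t : n.-tuple G),
             f [tuple of map (mulg s) t] = gscale s (f t))
          (equivariant f).
Proof.
apply: (iffP forallP) => [ef s t|ef s]; last by apply/forallP => t; apply/eqP.
by apply/eqP; move/forallP: (ef s); apply.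
Qed.

Lemma equivariant0 n : equivariant (0 : fn n).
Proof. by apply/equivariantP => s t; rewrite !ffunE raddf0. Qed.

Lemma equivariantB n (f g : fn n) :
  equivariant f -> equivariant g -> equivariant (f - g).
Proof.
move=> /equivariantP Hf /equivariantP Hg; apply/equivariantP => s t.
by rewrite !ffunE Hf Hg raddfB.
Qed.

Variable i : int.

Definition is_cocycle (f : fn (tate_width i)) : bool :=
  equivariant f && (diff_out f == 0).

Lemma is_cocycle_closed : zmod_closed is_cocycle.
Proof.
split=> [|f g]; first by rewrite unfold_in equivariant0 raddf0 eqxx.
rewrite !unfold_in => /andP[ef /eqP df] /andP[eg /eqP dg].
by rewrite equivariantB // diff_out_zmod df dg subrr eqxx.
Qed.

HB.instance Definition _ := GRing.isZmodClosed.Build _ is_cocycle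
  is_cocycle_closed.

Definition cocycle := {f : fn (tate_width i) | is_cocycle f}.

HB.instance Definition _ := SubType.on cocycle.
HB.instance Definition _ := Choice.on cocycle.
HB.instance Definition _ := [SubChoice_isSubZmodule of cocycle by <:].

Definition is_coboundary (z : cocycle) : bool :=
  `[< exists2 f, equivariant f & diff_in f = val z >].

Lemma is_coboundary_closed : zmod_closed is_coboundary.
Proof.
split=> [|y z].
  by apply/asboolP; exists 0; rewrite ?equivariant0 ?raddf0.
move=> /asboolP[f ef fy] /asboolP[g eg gz]; apply/asboolP.
by exists (f - g); rewrite ?equivariantB // diff_in_zmod fy gz.
Qed.

HB.instance Definition _ := GRing.isZmodClosed.Build _ is_coboundary
  is_coboundary_closed.

Definition coboundary : zmodClosed cocycle :=
  GRing.ZmodClosed.clone cocycle is_coboundary _.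

Definition tate := Quotient.quot coboundary.

HB.instance Definition _ := GRing.Zmodule.on tate.
HB.instance Definition _ := Quotient.on tate.

End Cochains.

Arguments coboundary {G} A i.
Arguments tate {G} A i.

Section TateMap.
Variables (G : finGroupType) (A B : gmodType G) (u : {linear A -> B}).

Definition cochain_map n (f : {ffun n.-tuple G -> A}) :
    {ffun n.-tuple G -> B} :=
  [ffun t => u (f t)].

Lemma cochain_map_zmod n : zmod_morphism (@cochain_map n).
Proof. by move=> f g; apply/ffunP => t; rewrite !ffunE raddfB. Qed.

HB.instance Definition _ n :=
  GRing.isZmodMorphism.Build _ _ (@cochain_map n) (@cochain_map_zmod n).

Lemma cochain_map_equivariant n (f : {ffun n.-tuple G -> A}) :
  equivariant f -> equivariant (cochain_map f).
Proof.
move=> /equivariantP ef; apply/equivariantP => s t.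
by rewrite !ffunE ef linear_gscale.
Qed.

Lemma diff_pos_map n (f : {ffun n.+1.-tuple G -> A}) :
  diff_pos (cochain_map f) = cochain_map (diff_pos f).
Proof.
apply/ffunP => t; rewrite !ffunE raddf_sum.
by apply: eq_bigr => i _; rewrite ffunE raddfMz.
Qed.

Lemma diff_norm_map (f : {ffun 1.-tuple G -> A}) :
  diff_norm (cochain_map f) = cochain_map (diff_norm f).
Proof.
apply/ffunP => t; rewrite !ffunE raddf_sum.
by apply: eq_bigr => s _; rewrite ffunE.
Qed.

Lemma diff_neg_map n (f : {ffun n.+2.-tuple G -> A}) :
  diff_neg (cochain_map f) = cochain_map (diff_neg f).
Proof.
apply/ffunP => t; rewrite !ffunE raddf_sum; apply: eq_bigr => s _.
by rewrite raddf_sum; apply: eq_bigr => i _; rewrite ffunE raddfMz.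
Qed.

Lemma diff_out_map i (f : {ffun (tate_width i).-tuple G -> A}) :
  diff_out (cochain_map f) = cochain_map (diff_out f).
Proof.
case: i f => [n|[|n]] f; [exact: diff_pos_map|exact: diff_norm_map|].
exact: diff_neg_map.
Qed.

Lemma diff_in_map i (f : {ffun (tate_width (int_pred i)).-tuple G -> A}) :
  diff_in (cochain_map f) = cochain_map (diff_in f).
Proof.
case: i f => [[|n]|n] f; [exact: diff_norm_map|exact: diff_pos_map|].
exact: diff_neg_map.
Qed.

Variable i : int.

Lemma cocycle_map_subproof (z : cocycle A i) :
  is_cocycle (cochain_map (val z)).
Proof.
case/andP: (valP z) => ez /eqP dz; rewrite /is_cocycle.
by rewrite cochain_map_equivariant // diff_out_map dz raddf0 eqxx.
Qed.

Definition cocycle_map (z : cocycle A i) : cocycle B i :=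
  Sub (cochain_map (val z)) (cocycle_map_subproof z).

Lemma cocycle_map_zmod : zmod_morphism cocycle_map.
Proof. by move=> y z; apply: val_inj; rewrite /= !raddfB. Qed.

HB.instance Definition _ :=
  GRing.isZmodMorphism.Build _ _ cocycle_map cocycle_map_zmod.

Lemma cocycle_map_coboundary z :
  is_coboundary z -> is_coboundary (cocycle_map z).
Proof.
move=> /asboolP[f ef dfz]; apply/asboolP; exists (cochain_map f).
  exact: cochain_map_equivariant.
by rewrite diff_in_map dfz.
Qed.

Definition tate_map (x : tate A i) : tate B i :=
  \pi_(tate B i) (cocycle_map (repr x)).

Lemma tate_map_pi z :
  tate_map (\pi_(tate A i) z) = \pi_(tate B i) (cocycle_map z).
Proof.
apply/eqP; rewrite /tate_map -Quotient.idealrBE -raddfB.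
apply: cocycle_map_coboundary.
by have := Quotient.idealrBE (coboundary A i) (repr (\pi_(tate A i) z)) z;
   rewrite reprK eqxx.
Qed.

Lemma tate_map_zmod : zmod_morphism tate_map.
Proof.
move=> x y; rewrite -[x]reprK -[y]reprK -raddfB.
by rewrite !tate_map_pi !raddfB.
Qed.

HB.instance Definition _ :=
  GRing.isZmodMorphism.Build _ _ tate_map tate_map_zmod.

End TateMap.

Arguments tate_map {G A B} u i x.

(** * Encoding pairs, free abelian groups, projective modules *)

Definition encoding_pair (G : finGroupType) (r : int) (X X' : gmodType G) :
    Prop :=
  exists (i : int)
    (phi : forall A : gmodType G,
       {additive tate (homZ X A) i -> tate (homZ X' A) (i + r)}),
    (forall A : gmodType G, bijective (phi A)) /\
    (forall (A B : gmodType G) (u : {linear A -> B}) (x : tate (homZ X A) i),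
       phi B (tate_map (@homZ_map G X A B u) i x) =
       tate_map (@homZ_map G X' A B u) (i + r) (phi A x)).

Definition is_Zbasis (X : zmodType) (I : choiceType) (b : I -> X) : Prop :=
  (forall x : X, exists (s : seq I) (c : I -> int),
     x = \sum_(k <- s) b k *~ c k) /\
  (forall (s : seq I) (c : I -> int), uniq s ->
     \sum_(k <- s) b k *~ c k = 0 -> forall k, k \in s -> c k = 0).

Definition Zfree (X : zmodType) : Prop :=
  exists (I : choiceType) (b : I -> X), is_Zbasis b.

Definition projective (R : nzRingType) (P : lmodType R) : Prop :=
  forall (M N : lmodType R) (f : {linear M -> N}) (g : {linear P -> N}),
    (forall y : N, exists x : M, f x = y) ->
    exists h : {linear P -> M}, forall x : P, f (h x) = g x.

(* There are projective modules P_n, ..., P_1 and a sequence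
     L --f--> M -> P_n -> ... -> P_1 -> X' -> 0
   that is exact at M, at every P_k and at X'. *)
Fixpoint exact_tail (R : nzRingType) (X' : lmodType R) (n : nat)
    (L M : lmodType R) (f : {linear L -> M}) : Prop :=
  match n with
  | 0 => exists g : {linear M -> X'},
      (forall x : M, g x = 0 <-> exists y : L, f y = x) /\
      (forall z : X', exists x : M, g x = z)
  | n'.+1 => exists (P : lmodType R) (g : {linear M -> P}),
      [/\ projective P,
          (forall x : M, g x = 0 <-> exists y : L, f y = x) &
          exact_tail X' n' g]
  end.

(* There is an exact sequence 0 -> X -> P_r -> ... -> P_1 -> X' -> 0 with every
   P_k projective; exactness at X is exactness after the zero map X -> X. *)
Definition projective_exact_sequence (R : nzRingType) (r : nat)
    (X X' : lmodType R) : Prop :=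
  exact_tail X' r (\0 : {linear X -> X}).

(* Main.v *)
(* Say that a G-module C is weakly projective if its identity is the norm of an
   additive endomorphism; Tate cohomology vanishes on such modules, and the
   connecting maps of a Z-split sequence 0 -> X -> P -> K -> 0 with P projective
   give H^i(G, Hom(X, -)) = H^(i+1)(G, Hom(K, -)). Splicing a long exact sequence
   of projectives yields the "if" part.

   Conversely, shifting A along 0 -> Omega A -> Ind A -> A -> 0 and
   0 -> A -> Ind A -> Sigma A -> 0 moves an encoding isomorphism to i = 0, and
   X' is replaced by its r-th syzygy Y. As H^0(G, Hom(X, A)) is Hom_G(X, A)
   modulo norms, Yoneda gives X -> Y and Y -> X that are mutually inverse modulo
   norms. Then X is a summand of Y + Ind X whose complement is projective, and
   splitting that complement off the last projective of the resolution of X'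
   puts X in place of Y. *)

Require Import Defs.
From HB Require Import structures.
From mathcomp Require Import all_boot all_algebra all_fingroup.
From mathcomp Require Import generic_quotient ring_quotient.
From mathcomp Require Import zify boolp.

Set Implicit Arguments.
Unset Strict Implicit.
Unset Printing Implicit Defensive.

Import GRing.Theory.
Local Open Scope ring_scope.
Local Open Scope quotient_scope.

(** * Additive and linear maps obtained from functions and relations *)

Lemma exists_linear (R : pzRingType) (M N : lmodType R) (f : M -> N) :
  linear f -> exists g : {linear M -> N}, g =1 f.
Proof.
move=> lf; pose g : {linear M -> N} :=
  HB.pack f (GRing.isLinear.Build _ _ _ _ f lf).
by exists g.
Qed.

Lemma exists_additive (A B : zmodType) (f : A -> B) :
  zmod_morphism f -> exists g : {additive A -> B}, g =1 f.
Proof.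
move=> af; pose g : {additive A -> B} :=
  HB.pack f (GRing.isZmodMorphism.Build _ _ f af).
by exists g.
Qed.

Lemma linear_of_gscale (G : finGroupType) (M N : gmodType G) (f : M -> N) :
  zmod_morphism f -> (forall g x, f (gscale g x) = gscale g (f x)) ->
  linear f.
Proof.
move=> /exists_additive[h hE] fg a x y; rewrite -!hE raddfD; congr (_ + _).
rewrite !scaler_gscale raddf_sum; apply: eq_bigr => g _.
by rewrite raddfMz !hE fg.
Qed.

(** Two values related to the same element differ by something related to 0, hence agree, so the
    relation is the graph of an additive map. This serves for maps defined through a choice of
    representatives, such as connecting maps. *)
Lemma additive_of_rel (A B : zmodType) (R : A -> B -> Prop) :
  (forall x, exists y, R x y) ->
  (forall x y x' y', R x y -> R x' y' -> R (x - x') (y - y')) ->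
  (forall y, R 0 y -> y = 0) ->
  exists f : {additive A -> B}, forall x, R x (f x).
Proof.
move=> tot sub fun0; have [f fR] := choice tot.
have fE x y : R x y -> y = f x.
  by move=> /sub /(_ (fR x)); rewrite subrr => /fun0/eqP;
    rewrite subr_eq0 => /eqP.
have [|g gf] := @exists_additive _ _ f; last by exists g => x; rewrite gf.
by move=> x y; apply/esym/fE/sub.
Qed.

Lemma additive_factor (L C X : zmodType) (j : {additive L -> C})
    (f : {additive X -> C}) :
  injective j -> (forall x, exists y, j y = f x) ->
  exists g : {additive X -> L}, forall x, j (g x) = f x.
Proof.
move=> jI fj; apply: (@additive_of_rel _ _ (fun x y => j y = f x)) => //.
  by move=> x y x' y' jy jy'; rewrite !raddfB jy jy'.
by move=> y; rewrite raddf0 -(raddf0 j); apply: jI.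
Qed.

(** * Z-projective groups *)

Definition Zprojective (P : zmodType) : Prop :=
  forall (A B : zmodType) (f : {additive A -> B}) (g : {additive P -> B}),
    (forall y, exists x, f x = y) ->
    exists h : {additive P -> A}, forall x, f (h x) = g x.

Lemma Zprojective_section (A P : zmodType) (f : {additive A -> P}) :
  Zprojective P -> (forall y, exists x, f x = y) ->
  exists s : {additive P -> A}, forall x, f (s x) = x.
Proof. by move=> Pproj; apply: (Pproj _ _ f idfun). Qed.

Lemma Zprojective_retract (P Q : zmodType) (s : {additive Q -> P})
    (p : {additive P -> Q}) :
  cancel s p -> Zprojective P -> Zprojective Q.
Proof.
move=> sK Pproj A B f g fsurj.
have [h hE] := Pproj A B f (g \o p : {additive _ -> _}) fsurj.
by exists (h \o s : {additive _ -> _}) => x /=; rewrite hE /= sK.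
Qed.

Lemma Zprojective_prod (P Q : zmodType) :
  Zprojective P -> Zprojective Q -> Zprojective (P * Q)%type.
Proof.
move=> Pproj Qproj A B f g fsurj.
have [i iE] : exists i : {additive P -> P * Q}, i =1 (fun x => (x, 0)).
  by apply: exists_additive => x y; congr (_, _); rewrite subr0.
have [j jE] : exists j : {additive Q -> P * Q}, j =1 (fun x => (0, x)).
  by apply: exists_additive => x y; congr (_, _); rewrite subr0.
have [h hE] := Pproj _ _ f (g \o i : {additive _ -> _}) fsurj.
have [k kE] := Qproj _ _ f (g \o j : {additive _ -> _}) fsurj.
exists ((h \o fst) \+ (k \o snd) : {additive _ -> _}) => -[x y] /=.
rewrite raddfD hE kE /= -raddfD iE jE; congr (g (_, _)) => /=.
  by rewrite addr0.
by rewrite add0r.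
Qed.

Lemma Zprojective_ffun (I : finType) (P : zmodType) :
  Zprojective P -> Zprojective {ffun I -> P}.
Proof.
move=> Pproj A B f g fsurj.
have dP i : exists h : {additive P -> A}, forall x,
    f (h x) = g [ffun j => if j == i then x else 0].
  have [|d dE] := @exists_additive P {ffun I -> P}
    (fun x => [ffun j => if j == i then x else 0]).
    move=> x y; apply/ffunP => j; rewrite !ffunE.
    by case: eqP => // _; rewrite subr0.
  have [h hE] := Pproj _ _ f (g \o d : {additive _ -> _}) fsurj.
  by exists h => x; rewrite hE /= dE.
have [h hE] := choice dP.
have [|k kE] := @exists_additive {ffun I -> P} A
  (fun x => \sum_i h i (x i)).
  by move=> x y; rewrite -sumrB; apply: eq_bigr => i _; rewrite !ffunE raddfB.
exists k => x; rewrite kE raddf_sum; under eq_bigr do rewrite hE.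
rewrite -raddf_sum; congr (g _); apply/ffunP => j; rewrite sum_ffunE.
rewrite (bigD1 j) //= ffunE eqxx big1 ?addr0 // => i /negbTE.
by rewrite ffunE eq_sym => ->.
Qed.

(** Lift the images of the basis elements and extend additively. Coefficients over a finite list are
    not literally unique, so the extension is first described as a relation. *)
Lemma Zfree_Zprojective (X : zmodType) : Zfree X -> Zprojective X.
Proof.
case=> I [b [bgen bfree]] A B f g fsurj.
have [a aE] := choice (fun k => fsurj (g (b k))).
(* y is the image under b k |-> a k of some expression of x in the basis. *)
pose R x y := exists (s : seq I) (c : I -> int), [/\ uniq s,
  forall k, k \notin s -> c k = 0, x = \sum_(k <- s) b k *~ c k &
  y = \sum_(k <- s) a k *~ c k].
(* Padding the list with zero coefficients leaves the sum unchanged, so two expressions can be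
   subtracted over a common list. *)
have extend (M : zmodType) (m : I -> M) s s' (c : I -> int) :
    uniq s -> uniq s' -> {subset s <= s'} ->
    (forall k, k \notin s -> c k = 0) ->
    \sum_(k <- s) m k *~ c k = \sum_(k <- s') m k *~ c k.
  move=> us us' ss' c0; rewrite [RHS](bigID (mem s)) /= [X in _ + X]big1.
    rewrite addr0 -[RHS]big_filter; apply: perm_big; apply: uniq_perm => //.
      exact: filter_uniq.
    by move=> k; rewrite mem_filter andb_idr //; apply: ss'.
  by move=> k /c0 ->; rewrite mulr0z.
have [|||h hR] := @additive_of_rel X A R.
- move=> x; have [s [c ->]] := bgen x.
  (* The list given by the generation property may repeat elements; the multiplicities are absorbed
     into the coefficients. *)
  exists (\sum_(k <- undup s) a k *~ (c k *+ count_mem k s)), (undup s).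
  exists (fun k => c k *+ count_mem k s); split=> //.
  + exact: undup_uniq.
  + by move=> k; rewrite mem_undup => /count_memPn ->; rewrite mulr0n.
  + rewrite -big_undup_iterop_count /=; apply: eq_bigr => k _.
    by rewrite -[LHS]/(_ *+ _) pmulrn -mulrzA -[in RHS]mulr_natr natz.
- move=> x y x' y' [s [c [us c0 -> ->]]] [s' [c' [us' c'0 -> ->]]].
  exists (undup (s ++ s')), (fun k => c k - c' k); split.
  + exact: undup_uniq.
  + by move=> k; rewrite mem_undup mem_cat => /norP[/c0 -> /c'0 ->];
    rewrite subrr.
  + under [RHS]eq_bigr do rewrite mulrzBr; rewrite sumrB.
    by congr (_ - _); apply: extend; rewrite ?undup_uniq // => k;
      rewrite mem_undup mem_cat => ->; rewrite ?orbT.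
  + under [RHS]eq_bigr do rewrite mulrzBr; rewrite sumrB.
    by congr (_ - _); apply: extend; rewrite ?undup_uniq // => k;
      rewrite mem_undup mem_cat => ->; rewrite ?orbT.
- move=> y [s [c [us c0 xE ->]]]; rewrite big_seq big1 // => k ks.
  by rewrite (bfree s c us (esym xE) k ks) mulr0z.
exists h => x; have [s [c [_ _ xE ->]]] := hR x.
rewrite raddf_sum [in RHS]xE raddf_sum; apply: eq_bigr => k _.
by rewrite !raddfMz aE.
Qed.

(** * Submodules *)

Section Submodule.
Variables (R : pzRingType) (M : lmodType R) (S : submodClosed M).

Definition submod := {x : M | x \in S}.

HB.instance Definition _ := SubType.on submod.
HB.instance Definition _ := Choice.on submod.
HB.instance Definition _ := [SubChoice_isSubLmodule of submod by <:].

Lemma submod_lift (L : lmodType R) (f : {linear L -> M}) :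
  (forall x, f x \in S) ->
  exists g : {linear L -> submod}, forall x, val (g x) = f x.
Proof.
move=> fS; have [|g gE] := @exists_linear R L submod (fun x => Sub (f x) (fS
  x)).
  by move=> a x y; apply: val_inj; rewrite [RHS]linearP !SubK linearP.
by exists g => x; rewrite gE.
Qed.

End Submodule.

Section KernelImage.
Variables (R : pzRingType) (M N : lmodType R) (f : {linear M -> N}).

Definition kernel_pred (x : M) : bool := f x == 0.

Lemma kernel_closed : submod_closed kernel_pred.
Proof.
split=> [|a x y]; rewrite !unfold_in ?raddf0 // => /eqP fx /eqP fy.
by rewrite linearP fx fy scaler0 addr0.
Qed.

HB.instance Definition _ :=
  GRing.isSubmodClosed.Build R M kernel_pred kernel_closed.

Definition kernel_submod : submodClosed M := GRing.SubmodClosed.clone R M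
  kernel_pred _.

Lemma kernel_submodP x : reflect (f x = 0) (x \in kernel_submod).
Proof. exact: eqP. Qed.

Definition image_pred (y : N) : bool := `[< exists x, f x = y >].

Lemma image_closed : submod_closed image_pred.
Proof.
split=> [|a x y]; rewrite !unfold_in; first by apply/asboolP; exists 0;
  rewrite raddf0.
move=> /asboolP[x' <-] /asboolP[y' <-]; apply/asboolP.
by exists (a *: x' + y'); rewrite linearP.
Qed.

HB.instance Definition _ :=
  GRing.isSubmodClosed.Build R N image_pred image_closed.

Definition image_submod : submodClosed N := GRing.SubmodClosed.clone R N
  image_pred _.

Lemma image_submodP y : reflect (exists x, f x = y) (y \in image_submod).
Proof. exact: asboolP. Qed.

End KernelImage.

Definition submod_map (R : pzRingType) (M N : lmodType R) (S : submodClosed M)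
    (T : submodClosed N) (u : {linear M -> N})
    (uST : forall x, x \in S -> u x \in T) : {linear submod S -> submod T} :=
  projT1 (cid (@submod_lift R N T _ (u \o val : {linear submod S -> N})
    (fun x => uST _ (valP x)))).

Lemma submod_mapE (R : pzRingType) (M N : lmodType R) (S : submodClosed M)
    (T : submodClosed N) (u : {linear M -> N})
    (uST : forall x, x \in S -> u x \in T) x :
  val (submod_map uST x) = u (val x).
Proof. by rewrite /submod_map; case: cid => g /= ->. Qed.

(** * Norms and weakly projective modules *)

Section RelNorm.
Variables (G : finGroupType) (M N : gmodType G).

(** The norm of [a] for the conjugation action of G on maps from M to N. *)
Definition relnorm (a : M -> N) (x : M) : N :=
  \sum_(s : G) gscale s (a (gscale s^-1%g x)).

Lemma relnorm_linear (a : {additive M -> N}) :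
  exists f : {linear M -> N}, f =1 relnorm a.
Proof.
apply/exists_linear/linear_of_gscale => [x y|g x].
  by rewrite -sumrB; apply: eq_bigr => s _; rewrite !raddfB.
rewrite raddf_sum [LHS](reindex_inj (mulgI g)) /=; apply: eq_bigr => s _.
by rewrite invMg -gscaleM mulgKV gscaleM.
Qed.

Lemma eq_relnorm (a b : M -> N) : a =1 b -> relnorm a =1 relnorm b.
Proof. by move=> ab x; apply: eq_bigr => s _; rewrite ab. Qed.

End RelNorm.

Lemma relnorm_comp_l (G : finGroupType) (M N K : gmodType G)
    (u : {linear N -> K}) (a : M -> N) x :
  relnorm (u \o a) x = u (relnorm a x).
Proof. by rewrite /relnorm raddf_sum; apply: eq_bigr => s _ /=;
  rewrite linear_gscale. Qed.

Lemma relnorm_comp_r (G : finGroupType) (M N K : gmodType G)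
    (a : N -> K) (u : {linear M -> N}) x :
  relnorm (a \o u) x = relnorm a (u x).
Proof. by apply: eq_bigr => s _; rewrite -linear_gscale. Qed.

Definition weakly_projective (G : finGroupType) (M : gmodType G) : Prop :=
  exists t : {additive M -> M}, forall x, relnorm t x = x.

Lemma weakly_projective_retract (G : finGroupType) (M N : gmodType G)
    (s : {linear N -> M}) (p : {linear M -> N}) :
  cancel s p -> weakly_projective M -> weakly_projective N.
Proof.
move=> sK [t tE]; exists (p \o t \o s : {additive N -> N}) => x.
by rewrite (relnorm_comp_r (p \o t) s) relnorm_comp_l tE.
Qed.

Lemma weakly_projective_prod (G : finGroupType) (M N : gmodType G) :
  weakly_projective M -> weakly_projective N ->
  weakly_projective (M * N)%type.
Proof.
move=> [t tE] [r rE].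
have [|w wE] := @exists_additive (M * N)%type (M * N)%type (fun x => (t x.1, r
  x.2)).
  by move=> x y; rewrite /= !raddfB.
exists w => -[x y].
rewrite (eq_relnorm wE); apply: injective_projections.
  by rewrite [LHS](raddf_sum fst) -[RHS]tE.
by rewrite [LHS](raddf_sum snd) -[RHS]rE.
Qed.

(** If [k] is an additive lift of [g] and [t] has norm 1, the norm of [k \o t] is an equivariant
    lift: [f] carries it to the norm of [g \o t], which is [g] composed with the norm of [t]. *)
Lemma projective_of_Zprojective (G : finGroupType) (P : gmodType G) :
  Zprojective P -> weakly_projective P -> projective P.
Proof.
move=> Pproj [t tE] M N f g fsurj.
have [k kE] := Pproj M N f g fsurj.
have [h hE] := relnorm_linear (k \o t : {additive P -> M}).
exists h => x; rewrite hE -relnorm_comp_l.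
rewrite (@eq_relnorm _ _ _ _ (g \o t)) ?relnorm_comp_l ?tE // => y /=.
exact: kE.
Qed.

(** * Induced modules *)

Section Induced.
Variables (G : finGroupType) (A : zmodType).

(** As G is finite, functions under translation serve both as the induced and as the coinduced
    module. *)
Definition induced := {ffun G -> A}.

HB.instance Definition _ := GRing.Zmodule.on induced.

Definition induced_act (s : G) (f : induced) : induced :=
  [ffun t => f (s^-1 * t)%g].

Lemma induced_act_zmod s : zmod_morphism (induced_act s).
Proof. by move=> f g; apply/ffunP => t; rewrite !ffunE. Qed.

Lemma induced_act1 f : induced_act 1%g f = f.
Proof. by apply/ffunP => t; rewrite ffunE invg1 mul1g. Qed.

Lemma induced_actM g h f :
  induced_act (g * h)%g f = induced_act g (induced_act h f).
Proof. by apply/ffunP => t; rewrite !ffunE invMg mulgA. Qed.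

HB.instance Definition _ :=
  Zmodule_isGModule.Build G induced induced_act_zmod induced_act1 induced_actM.

Lemma gscale_induced s (f : induced) t : gscale s f t = f (s^-1 * t)%g.
Proof.
have -> : gscale s f = induced_act s f; last by rewrite ffunE.
rewrite [LHS](bigD1 s) //= ffunE eqxx mulr1z big1 ?addr0 // => h hng.
by rewrite ffunE (negbTE hng) mulr0z.
Qed.

(** Take [t] to keep the value at 1 and erase the others. Its conjugate by [s] keeps the value at
    [s], and these projections add up to the identity. *)
Lemma induced_weakly_projective : weakly_projective induced.
Proof.
have [|t tE] := @exists_additive induced induced
  (fun f => [ffun u => if u == 1%g then f u else 0]).
  move=> f g; apply/ffunP => u; rewrite !ffunE.
  by case: eqP => // _; rewrite subr0.
exists t => f; rewrite (eq_relnorm tE); apply/ffunP => u.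
rewrite sum_ffunE (bigD1 u) //= gscale_induced ffunE mulVg eqxx.
rewrite gscale_induced invgK mulg1 big1 ?addr0 // => s su.
by rewrite gscale_induced ffunE -eq_mulVg1 (negbTE su).
Qed.

(** Frobenius reciprocity, in its coinduced form. *)
Lemma induced_lift (M : gmodType G) (a : {additive M -> A}) :
  exists f : {linear M -> induced}, forall x t, f x t = a (gscale t^-1%g x).
Proof.
have [|f fE] := @exists_linear _ M induced
    (fun x => [ffun t => a (gscale t^-1%g x)]).
  apply: linear_of_gscale => [x y|s x]; apply/ffunP => t.
    by rewrite !ffunE !raddfB.
  by rewrite gscale_induced !ffunE invMg invgK gscaleM.
by exists f => x t; rewrite fE ffunE.
Qed.

End Induced.

Lemma induced_map (G : finGroupType) (A B : zmodType) (u : {additive A -> B}) :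
  exists f : {linear induced G A -> induced G B}, forall x t, f x t = u (x t).
Proof.
have [|f fE] := @exists_linear _ (induced G A) (induced G B)
    (fun x => [ffun t => u (x t)]).
  apply: linear_of_gscale => [x y|s x]; apply/ffunP => t.
    by rewrite !ffunE raddfB.
  by rewrite !(gscale_induced, ffunE).
by exists f => x t; rewrite fE ffunE.
Qed.

Lemma induced_sum (G : finGroupType) (M : gmodType G) :
  exists p : {linear induced G M -> M},
    forall f, p f = \sum_(t : G) gscale t (f t).
Proof.
apply/exists_linear/linear_of_gscale => [f g|s f].
  by rewrite -sumrB; apply: eq_bigr => t _; rewrite !ffunE raddfB.
rewrite raddf_sum [LHS](reindex_inj (mulgI s)) /=; apply: eq_bigr => t _.
by rewrite gscale_induced mulKg gscaleM.
Qed.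

Lemma induced_projective (G : finGroupType) (A : zmodType) :
  Zprojective A -> projective (induced G A).
Proof.
move=> Aproj; apply: projective_of_Zprojective.
  exact: (@Zprojective_ffun G A Aproj).
exact: induced_weakly_projective.
Qed.

Section Sum.
Variables (G : finGroupType) (M : gmodType G).

Definition induced_to : {linear induced G M -> M} := projT1 (cid (induced_sum
  M)).

Lemma induced_toE f : induced_to f = \sum_(t : G) gscale t (f t).
Proof. by rewrite /induced_to; case: cid. Qed.

Lemma induced_to_section : exists s : {additive M -> induced G M},
  cancel s induced_to.
Proof.
have [|s sE] := @exists_additive M (induced G M)
  (fun x => [ffun u => if u == 1%g then x else 0]).
  move=> f g; apply/ffunP => u; rewrite !ffunE.
  by case: eqP => // _; rewrite subr0.
exists s => x; rewrite induced_toE sE (bigD1 1%g) //= ffunE eqxx gscale1.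
by rewrite big1 ?addr0 // => t /negbTE; rewrite ffunE => ->; rewrite raddf0.
Qed.

End Sum.

(** The surjection from the module induced from [P] onto [P] splits equivariantly, so [P] is a
    retract of an induced module. *)
Lemma projective_weakly_projective (G : finGroupType) (P : gmodType G) :
  projective P -> weakly_projective P.
Proof.
move=> Pproj; have [s sK] := induced_to_section P.
have [|h hE] := Pproj (induced G P) P (induced_to P) idfun.
  by move=> y; exists (s y); apply: sK.
exact: (weakly_projective_retract hE (@induced_weakly_projective G P)).
Qed.

(** Coinduce the additive lifting problem to an equivariant one, solve it there, and evaluate the
    solution at 1. *)
Lemma projective_Zprojective (G : finGroupType) (P : gmodType G) :
  projective P -> Zprojective P.
Proof.
move=> Pproj A B f g fsurj.
have [f' f'E] := induced_map G f; have [g' g'E] := induced_lift g.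
have [|h hE] := Pproj (induced G A) (induced G B) f' g'.
  move=> y; have [k kE] := choice fsurj.
  exists [ffun t => k (y t)]; apply/ffunP => t.
  by rewrite f'E ffunE kE.
have [|h1 h1E] := @exists_additive P A (fun x => h x 1%g).
  by move=> x y; rewrite raddfB !ffunE.
exists h1 => x; rewrite h1E -f'E hE g'E invg1.
by rewrite gscale1.
Qed.

(** * The complete standard complex *)

Section Complex.
Variables (G : finGroupType) (A : gmodType G).
Local Notation fn n := {ffun n.-tuple G -> A}.

(* diff_pos and diff_neg extended to width 0, where they splice to
   diff_norm = face_sum \o insert_sum. *)
Definition face_sum n (f : fn n) : fn n.+1 :=
  [ffun t => \sum_(i < n.+1) f (tuple_del i t) *~ (-1) ^+ i].

Definition insert_sum n (f : fn n.+1) : fn n :=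
  [ffun t => \sum_(s : G) \sum_(i < n.+1) f (tuple_ins i s t) *~ (-1) ^+ i].

Definition slice n (x : G) (f : fn n.+1) : fn n :=
  [ffun t : n.-tuple G => f [tuple of x :: t]].

Lemma face_sum_zmod n : zmod_morphism (@face_sum n).
Proof.
move=> f g; apply/ffunP => t; rewrite !ffunE -sumrB.
by apply: eq_bigr => i _; rewrite !ffunE mulrzBl.
Qed.

Lemma insert_sum_zmod n : zmod_morphism (@insert_sum n).
Proof.
move=> f g; apply/ffunP => t; rewrite !ffunE -sumrB.
apply: eq_bigr => s _; rewrite -sumrB.
by apply: eq_bigr => i _; rewrite !ffunE mulrzBl.
Qed.

HB.instance Definition _ n :=
  GRing.isZmodMorphism.Build _ _ (@face_sum n) (@face_sum_zmod n).
HB.instance Definition _ n :=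
  GRing.isZmodMorphism.Build _ _ (@insert_sum n) (@insert_sum_zmod n).

Lemma tuple_del0 n x (t : n.-tuple G) : tuple_del ord0 [tuple of x :: t] = t.
Proof. by apply: eq_from_tnth => i; rewrite tnth_mktuple tnthS. Qed.

Lemma tuple_delS n (i : 'I_n.+1) x (t : n.+1.-tuple G) :
  tuple_del (lift ord0 i) [tuple of x :: t] = [tuple of x :: tuple_del i t].
Proof.
apply: eq_from_tnth => j; rewrite tnth_mktuple.
case: (unliftP ord0 j) => [k|] ->.
  rewrite [RHS]tnthS tnth_mktuple.
  have -> : lift (lift ord0 i) (lift ord0 k) = lift ord0 (lift i k).
    by apply: val_inj; rewrite /= /bump !leq0n !add1n ltnS addnS.
  by rewrite tnthS.
have -> : lift (lift ord0 i) ord0 = ord0 by apply: val_inj.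
by rewrite !tnth0.
Qed.

Lemma tuple_ins0 n s (t : n.-tuple G) : tuple_ins ord0 s t = [tuple of s :: t].
Proof.
apply: eq_from_tnth => j; rewrite tnth_mktuple.
case: (unliftP ord0 j) => [k|] ->; last by rewrite tnth0.
by rewrite tnthS.
Qed.

Lemma tuple_insS n (i : 'I_n.+1) s x (t : n.-tuple G) :
  tuple_ins (lift ord0 i) s [tuple of x :: t] = [tuple of x :: tuple_ins i s t].
Proof.
apply: eq_from_tnth => j; rewrite tnth_mktuple.
case: (unliftP ord0 j) => [k|] ->.
  rewrite [RHS]tnthS tnth_mktuple; case: (unliftP i k) => [l|] ->.
    have -> : lift ord0 (lift i l) = lift (lift ord0 i) (lift ord0 l).
      by apply: val_inj; rewrite /= /bump !leq0n !add1n ltnS addnS.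
    by rewrite liftK tnthS.
  by rewrite unlift_none.
have -> : ord0 = lift (lift ord0 i) ord0 by apply: val_inj.
by rewrite liftK !tnth0.
Qed.

(** The face deleting [x] is split off; the others fix [x] and change sign because their index moves
    by one. This recursion, and its analogue for insertions, allow induction on the width in place
    of manipulating pairs of indices. *)
Lemma face_sum_cons n (f : fn n.+1) x (t : n.+1.-tuple G) :
  face_sum f [tuple of x :: t] = f t - face_sum (slice x f) t.
Proof.
rewrite !ffunE big_ord_recl tuple_del0 expr0 mulr1z -sumrN; congr (_ + _).
apply: eq_bigr => i _.
by rewrite tuple_delS ffunE lift0 exprS mulN1r mulrNz.
Qed.

Lemma insert_sum_cons n (f : fn n.+2) x (t : n.-tuple G) :
  insert_sum f [tuple of x :: t] =
  \sum_(s : G) f [tuple of s :: [tuple of x :: t]] - insert_sum (slice x f) t.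
Proof.
rewrite !ffunE -sumrB; apply: eq_bigr => s _.
rewrite big_ord_recl tuple_ins0 expr0 mulr1z -sumrN; congr (_ + _).
apply: eq_bigr => i _.
by rewrite tuple_insS ffunE lift0 exprS mulN1r mulrNz.
Qed.

Lemma face_sum0 (f : fn 0) t : face_sum f t = f [tuple].
Proof. by rewrite ffunE big_ord1 expr0 mulr1z; congr (f _); apply: tuple0. Qed.

Lemma insert_sum0 (f : fn 1) t : insert_sum f t = \sum_(s : G) f [tuple s].
Proof.
rewrite ffunE; apply: eq_bigr => s _; rewrite big_ord1 expr0 mulr1z.
by rewrite [t]tuple0 tuple_ins0; congr (f _); apply: val_inj.
Qed.

Lemma diff_normE (f : fn 1) : diff_norm f = face_sum (insert_sum f).
Proof. by apply/ffunP => t; rewrite face_sum0 insert_sum0 ffunE. Qed.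

Lemma face_sum_slice n x (f : fn n.+1) :
  slice x (face_sum f) = f - face_sum (slice x f).
Proof. by apply/ffunP => t; rewrite ffunE face_sum_cons !ffunE. Qed.

Lemma face_sumK n (f : fn n) : face_sum (face_sum f) = 0.
Proof.
elim: n f => [|n IHn] f; apply/ffunP => t; case/tupleP: t => x t.
  rewrite face_sum_cons face_sum0 face_sum0 ffunE face_sum0 subrr.
  by rewrite ffunE.
by rewrite face_sum_cons face_sum_slice face_sum_zmod IHn subr0 ffunE subrr
  ffunE.
Qed.

Lemma insert_sumK n (f : fn n.+2) : insert_sum (insert_sum f) = 0.
Proof.
elim: n f => [|n IHn] f; apply/ffunP => t.
  rewrite insert_sum0; under eq_bigr => s _.
    have -> : [tuple s] = [tuple of s :: [tuple]] by apply: val_inj.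
    rewrite insert_sum_cons insert_sum0.
    over.
  rewrite sumrB exchange_big /= ffunE; apply/eqP; rewrite subr_eq0; apply/eqP.
  apply: eq_bigr => r _; apply: eq_bigr => s _.
  by rewrite ffunE; congr (f _); apply: val_inj.
case/tupleP: t => x t; rewrite insert_sum_cons.
have slice_sum : slice x (insert_sum f) =
    \sum_(s : G) slice x (slice s f) - insert_sum (slice x f).
  apply/ffunP => u; rewrite ffunE insert_sum_cons !ffunE sum_ffunE.
  by congr (_ - _); apply: eq_bigr => s _; rewrite !ffunE.
rewrite slice_sum insert_sum_zmod IHn subr0 raddf_sum.
under eq_bigr do rewrite !insert_sum_cons opprB addrCA.
rewrite big_split /= sumrB; set a := (X in _ + (X - _));
  set b := (X in _ + (_ - X)).
(* The two double sums insert a pair in front of [x] in opposite orders and differ only by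
   exchanging the summation variables. *)
have -> : a = b.
  rewrite /a exchange_big; apply: eq_bigr => r _; apply: eq_bigr => s _.
  by rewrite ffunE.
by rewrite subrr addr0 sum_ffunE subrr ffunE.
Qed.

(** Fixing the first entry at 1 is a contracting homotopy. It is not equivariant, so this exactness
    is one of all cochains. *)
Lemma face_sum_exact n (f : fn n.+1) :
  face_sum f = 0 -> exists g, face_sum g = f.
Proof.
move=> df; exists (slice 1%g f); apply/ffunP => t; apply/eqP.
by rewrite eq_sym -subr_eq0 -face_sum_cons df ffunE.
Qed.

(** The contracting homotopy for insertions: a new first entry, with support at 1. *)
Definition cone n (f : fn n) : fn n.+1 :=
  [ffun t : n.+1.-tuple G => if thead t == 1%g then f [tuple of behead t] else
    0].

Lemma cone_cons n (f : fn n) x (t : n.-tuple G) :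
  cone f [tuple of x :: t] = if x == 1%g then f t else 0.
Proof. by rewrite ffunE theadE; case: (x =P 1%g) => // _; congr (f _);
  apply: val_inj. Qed.

Lemma sum_cone n (f : fn n) (t : n.-tuple G) :
  \sum_(s : G) cone f [tuple of s :: t] = f t.
Proof.
rewrite (bigD1 1%g) //= cone_cons eqxx big1 ?addr0 // => s /negbTE.
by rewrite cone_cons => ->.
Qed.

Lemma insert_sum_surj (f : fn 0) : exists g, insert_sum g = f.
Proof.
exists (cone f); apply/ffunP => t; rewrite insert_sum0 -(sum_cone f t).
apply: eq_bigr => s _; congr (cone f _); apply: val_inj => /=.
by rewrite [t]tuple0.
Qed.

Lemma insert_sum_exact n (f : fn n.+1) :
  insert_sum f = 0 -> exists g, insert_sum g = f.
Proof.
move=> df; exists (cone f); apply/ffunP => t; case/tupleP: t => x t.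
rewrite insert_sum_cons sum_cone.
have -> : slice x (cone f) = if x == 1%g then f else 0.
  apply/ffunP => u; rewrite ffunE cone_cons.
  by case: eqP => // _; rewrite ffunE.
by case: (x =P 1%g) => _; rewrite ?df ?raddf0 ffunE subr0.
Qed.

(** At the splice, degree 0 uses that [insert_sum] is onto width 0, and degree -1 that [face_sum] is
    injective on width 0. *)
Lemma diff_in_exact i (f : fn (tate_width i)) :
  diff_out f = 0 -> exists g, diff_in g = f.
Proof.
case: i f => [[|n]|[|n]] /= f df.
- have [g gf] := face_sum_exact df; have [h hg] := insert_sum_surj g.
  by exists h; rewrite diff_normE hg.
- exact: face_sum_exact.
- apply: insert_sum_exact; apply/ffunP => t.
  by rewrite [t]tuple0 -(face_sum0 _ [tuple 1%g]) -diff_normE df !ffunE.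
- exact: insert_sum_exact.
Qed.

Lemma diff_out_in i (f : fn (tate_width (int_pred i))) :
  diff_out (diff_in f) = 0.
Proof.
case: i f => [[|n]|[|n]] /= f.
- by rewrite diff_normE; apply: face_sumK.
- exact: face_sumK.
- by rewrite diff_normE insert_sumK raddf0.
- exact: insert_sumK.
Qed.

Lemma diff_out_out i (f : fn (tate_width i)) : diff_out (diff_out f) = 0.
Proof.
case: i f => [n|[|[|n]]] /= f.
- exact: face_sumK.
- by rewrite diff_normE; apply: face_sumK.
- by rewrite diff_normE insert_sumK raddf0.
- exact: insert_sumK.
Qed.

(** [diff_in] at [int_succ i] is [diff_out] at [i], but their types agree only after a case analysis
    on [i]. The predicate ranges over all widths so that it can be carried across. *)
Lemma diff_in_succ i (f : fn (tate_width (int_succ i))) (P : forall n, fn n ->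
  bool) :
  (exists2 g, P _ g & diff_in g = f) <-> (exists2 g, P _ g & diff_out g = f).
Proof. by case: i f => [n|[|n]]. Qed.

Definition translate n (s : G) (f : fn n) : fn n :=
  [ffun t : n.-tuple G => f [tuple of map (mulg s) t]].

Lemma tuple_del_map n (i : 'I_n.+1) s (t : n.+1.-tuple G) :
  tuple_del i [tuple of map (mulg s) t] =
  [tuple of map (mulg s) (tuple_del i t)].
Proof. by apply: eq_from_tnth => j; rewrite !(tnth_mktuple, tnth_map). Qed.

Lemma tuple_ins_map n (i : 'I_n.+1) s r (t : n.-tuple G) :
  tuple_ins i (s * r)%g [tuple of map (mulg s) t] =
  [tuple of map (mulg s) (tuple_ins i r t)].
Proof.
apply: eq_from_tnth => j; rewrite !(tnth_mktuple, tnth_map).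
by case: unlift => // k; rewrite tnth_map.
Qed.

Lemma face_sum_translate n s (f : fn n) :
  face_sum (translate s f) = translate s (face_sum f).
Proof.
by apply/ffunP => t; rewrite !ffunE; apply: eq_bigr => i _;
  rewrite ffunE tuple_del_map.
Qed.

Lemma insert_sum_translate n s (f : fn n.+1) :
  insert_sum (translate s f) = translate s (insert_sum f).
Proof.
apply/ffunP => t; rewrite !ffunE [RHS](reindex_inj (mulgI s)) /=.
apply: eq_bigr => r _; apply: eq_bigr => i _.
by rewrite ffunE tuple_ins_map.
Qed.

Lemma diff_in_translate i s (f : fn (tate_width (int_pred i))) :
  diff_in (translate s f) = translate s (diff_in f).
Proof.
case: i f => [[|n]|n] /= f;
  [|exact: face_sum_translate|exact: insert_sum_translate].
by rewrite !diff_normE insert_sum_translate face_sum_translate.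
Qed.

Lemma equivariant_translate n (f : fn n) :
  reflect (forall s, translate s f = [ffun t => gscale s (f t)]) (equivariant
    f).
Proof.
apply: (iffP (equivariantP f)) => [ef s|ef s t].
  by apply/ffunP => t; rewrite !ffunE ef.
by move/ffunP: (ef s) => /(_ t); rewrite !ffunE.
Qed.

End Complex.

Section PointwiseMap.
Variables (G : finGroupType) (A B : gmodType G) (u : {additive A -> B}).

(** Unlike in [cochain_map], [u] is merely additive, which admits [gscale s] and the endomorphism
    whose norm is the identity. *)
Definition pointwise n (f : {ffun n.-tuple G -> A}) : {ffun n.-tuple G -> B} :=
  [ffun t => u (f t)].

Lemma face_sum_pointwise n (f : {ffun n.-tuple G -> A}) :
  face_sum (pointwise f) = pointwise (face_sum f).
Proof.
apply/ffunP => t; rewrite !ffunE raddf_sum.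
by apply: eq_bigr => i _; rewrite ffunE raddfMz.
Qed.

Lemma insert_sum_pointwise n (f : {ffun n.+1.-tuple G -> A}) :
  insert_sum (pointwise f) = pointwise (insert_sum f).
Proof.
apply/ffunP => t; rewrite !ffunE raddf_sum; apply: eq_bigr => s _.
by rewrite raddf_sum; apply: eq_bigr => i _; rewrite ffunE raddfMz.
Qed.

Lemma diff_in_pointwise i (f : {ffun (tate_width (int_pred i)).-tuple G -> A}) :
  diff_in (pointwise f) = pointwise (diff_in f).
Proof.
case: i f => [[|n]|n] /= f;
  [|exact: face_sum_pointwise|exact: insert_sum_pointwise].
by rewrite !diff_normE insert_sum_pointwise face_sum_pointwise.
Qed.

Lemma diff_out_pointwise i (f : {ffun (tate_width i).-tuple G -> A}) :
  diff_out (pointwise f) = pointwise (diff_out f).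
Proof.
case: i f => [n|[|n]] /= f;
  [exact: face_sum_pointwise| |exact: insert_sum_pointwise].
by rewrite !diff_normE insert_sum_pointwise face_sum_pointwise.
Qed.

End PointwiseMap.

(** * Vanishing of Tate cohomology on weakly projective modules *)

Section Equivariance.
Variables (G : finGroupType) (A : gmodType G).

Lemma diff_out_equivariant i (f : {ffun (tate_width i).-tuple G -> A}) :
  equivariant f -> equivariant (diff_out f).
Proof.
have trans s (g : {ffun (tate_width i).-tuple G -> A}) :
    diff_out (translate s g) = translate s (diff_out g).
  case: i g {f} => [n|[|n]] /= g;
    [exact: face_sum_translate| |exact: insert_sum_translate].
  by rewrite !diff_normE insert_sum_translate face_sum_translate.
move=> /equivariant_translate ef; apply/equivariant_translate => s.
by rewrite -trans ef (diff_out_pointwise (gscale s)).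
Qed.

Lemma diff_in_equivariant i (f : {ffun (tate_width (int_pred i)).-tuple G ->
  A}) :
  equivariant f -> equivariant (diff_in f).
Proof.
by case: i f => [[|n]|n]; [exact: (@diff_out_equivariant (Negz 0))
  |exact: (@diff_out_equivariant (Posz n))
  |exact: (@diff_out_equivariant (Negz n.+1))].
Qed.

(** Choose a primitive [g] that need not be equivariant and average [t \o g] over G. By equivariance
    of [f], the differential of the average is the norm of [t] applied to the values of [f], that is
    [f]. *)
Lemma weakly_projective_acyclic i (f : {ffun (tate_width i).-tuple G -> A}) :
  weakly_projective A -> equivariant f -> diff_out f = 0 ->
  exists2 g, equivariant g & diff_in g = f.
Proof.
move=> [t tE] ef /diff_in_exact[g gf].
pose gs s := pointwise (gscale s) (translate s^-1 (pointwise t g)).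
exists (\sum_(s : G) gs s).
  apply/equivariantP => r u; rewrite !sum_ffunE raddf_sum.
  rewrite [LHS](reindex_inj (mulgI r)) /=; apply: eq_bigr => s _.
  rewrite !ffunE -gscaleM; congr (gscale _ (t (g _))).
  by apply: eq_from_tnth => j; rewrite !tnth_map invMg mulgA mulgKV.
rewrite raddf_sum; apply/ffunP => u; rewrite sum_ffunE -[RHS]tE.
apply: eq_bigr => s _ /=; rewrite /gs diff_in_pointwise diff_in_translate.
rewrite diff_in_pointwise gf !ffunE; congr (gscale s (t _)).
exact: (equivariantP f ef).
Qed.

End Equivariance.

(** * The connecting isomorphism *)

Lemma tate_eq0 (G : finGroupType) (A : gmodType G) i (z : cocycle A i) :
  \pi_(tate A i) z = 0 <-> exists2 f, equivariant f & diff_in f = val z.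
Proof.
have -> : (exists2 f, equivariant f & diff_in f = val z) <-> is_coboundary z.
  by split=> /asboolP.
rewrite -(raddf0 (\pi_(tate A i))).
by split=> [/eqP|zB]; [|apply/eqP]; rewrite -Quotient.idealrBE subr0.
Qed.

Section Cochains.
Variables (G : finGroupType) (A B : gmodType G) (u : {linear A -> B}).

Lemma cochain_map_inj n : injective u -> injective (@cochain_map G A B u n).
Proof.
move=> uI f g /ffunP fg; apply/ffunP => t; apply: uI.
by have := fg t; rewrite !ffunE.
Qed.

(** Tate widths are positive, so each tuple is a translate, by its first entry, of a tuple starting
    with 1. Lift the values on the latter arbitrarily and transport them by the action. *)
Lemma cochain_lift i (f : {ffun (tate_width i).-tuple G -> B}) :
  (forall y, exists x, u x = y) -> equivariant f ->
  exists2 g, equivariant g & cochain_map u g = f.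
Proof.
move=> usurj ef; have [s sK] := choice usurj.
have wS : tate_width i = (tate_width i).-1.+1 by case: (i).
pose hd (t : (tate_width i).-tuple G) := tnth t (cast_ord (esym wS) ord0).
pose shift r (t : (tate_width i).-tuple G) := [tuple of map (mulg r) t].
exists [ffun t => gscale (hd t) (s (f (shift (hd t)^-1%g t)))].
  apply/equivariantP => r t; rewrite !ffunE {1 2}/hd tnth_map gscaleM.
  congr (gscale _ (gscale _ (s (f _)))).
  by apply: eq_from_tnth => j; rewrite !tnth_map invMg mulgA mulgKV.
apply/ffunP => t; rewrite !ffunE linear_gscale sK (equivariantP f ef).
by rewrite -gscaleM mulgV gscale1.
Qed.

Lemma cochain_lift_inj n (f : {ffun n.-tuple G -> B}) :
  injective u -> (forall t, exists x, u x = f t) -> equivariant f ->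
  exists2 g, equivariant g & cochain_map u g = f.
Proof.
move=> uI /choice[g gE] /equivariantP ef; exists [ffun t => g t].
  by apply/equivariantP => s t; apply: uI; rewrite linear_gscale !ffunE !gE ef.
by apply/ffunP => t; rewrite !ffunE gE.
Qed.

End Cochains.

Definition short_exact (R : pzRingType) (L C B : lmodType R)
    (j : {linear L -> C}) (p : {linear C -> B}) : Prop :=
  [/\ injective j, forall x, p x = 0 <-> exists y, j y = x &
      forall z, exists x, p x = z].

Lemma short_exact_retraction (R : pzRingType) (L C B : lmodType R)
    (j : {linear L -> C}) (p : {linear C -> B}) (s : {additive B -> C}) :
  short_exact j p -> cancel s p ->
  exists r : {additive C -> L}, forall x, j (r x) = x - s (p x).
Proof.
move=> [jI pj _] sK.
apply: (@additive_factor _ _ C j (idfun \- (s \o p)) jI) => x.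
by apply/pj; rewrite raddfB /= sK subrr.
Qed.

Lemma short_exact_Zprojective (R : pzRingType) (L C B : lmodType R)
    (j : {linear L -> C}) (p : {linear C -> B}) (s : {additive B -> C}) :
  short_exact j p -> cancel s p -> Zprojective C -> Zprojective L.
Proof.
move=> jp sK; have [r rE] := short_exact_retraction jp sK.
have [jI pj _] := jp; apply: (@Zprojective_retract C L j r) => x.
have pjx : p (j x) = 0 by apply/pj; exists x.
by apply: jI; rewrite rE pjx raddf0 subr0.
Qed.

Section Connecting.
Variables (G : finGroupType) (L C B : gmodType G).
Variables (j : {linear L -> C}) (p : {linear C -> B}).

(** The graph of the snake map: [c] lifts a cocycle representing [x], and its differential comes
    from a cocycle representing [y]. *)
Definition connecting i (x : tate B i) (y : tate L (int_succ i)) : Prop :=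
  exists (c : {ffun (tate_width i).-tuple G -> C})
         (b : cocycle B i) (l : cocycle L (int_succ i)),
    [/\ equivariant c, cochain_map p c = val b,
        diff_out c = cochain_map j (val l),
        x = \pi_(tate B i) b & y = \pi_(tate L (int_succ i)) l].

Lemma connecting_sub i (x : tate B i) y x' y' :
  connecting x y -> connecting x' y' -> connecting (x - x') (y - y').
Proof.
move=> [c [b [l [ec cb cl -> ->]]]] [c' [b' [l' [ec' cb' cl' -> ->]]]].
exists (c - c'), (b - b'), (l - l'); split.
- exact: equivariantB.
- by rewrite [RHS]raddfB /= -cb -cb' -cochain_map_zmod.
- by rewrite diff_out_zmod cl cl' -cochain_map_zmod -raddfB.
- by rewrite raddfB.
- by rewrite raddfB.
Qed.

Hypothesis jp : short_exact j p.

Let jI : injective j. Proof. by case: jp. Qed.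
Let pj x : p (j x) = 0. Proof. by case: jp => _ /(_ (j x)) [_ ->] //;
  exists x. Qed.
Let p_surj z : exists x, p x = z. Proof. by case: jp. Qed.

Let pj_cochain n (f : {ffun n.-tuple G -> L}) :
  cochain_map p (cochain_map j f) = 0.
Proof. by apply/ffunP => t; rewrite !ffunE pj. Qed.

Let kernel_cochain n (f : {ffun n.-tuple G -> C}) :
  equivariant f -> cochain_map p f = 0 ->
  exists2 g, equivariant g & cochain_map j g = f.
Proof.
move=> ef pf; apply: cochain_lift_inj => // t.
by case: jp => _ /(_ (f t))[+ _] _; apply; move/ffunP: pf => /(_ t);
  rewrite !ffunE.
Qed.

Lemma connecting_total i (x : tate B i) : exists y, connecting x y.
Proof.
pose b := repr x; have /andP[eb /eqP db] := valP b.
have [c ec cb] := cochain_lift p_surj eb.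
have [||l el lc] := @kernel_cochain _ (diff_out c).
- exact: diff_out_equivariant.
- by rewrite -diff_out_map cb db.
have cl : is_cocycle l.
  rewrite /is_cocycle el; apply/eqP/(cochain_map_inj jI).
  by rewrite -diff_out_map lc diff_out_out raddf0.
exists (\pi_(tate L (int_succ i)) (Sub l cl)), c, b, (Sub l cl).
by split; rewrite ?lc ?reprK.
Qed.

(** This gives single-valuedness: if [b] is the differential of [b'], lift [b'] to [c']; then
    [c - diff_in c'] comes from [L] and exhibits [l] as a coboundary. *)
Lemma connecting_inj i (y : tate L (int_succ i)) :
  connecting (0 : tate B i) y -> y = 0.
Proof.
move=> [c [b [l [ec cb cl /esym/tate_eq0[b' eb' db'] ->]]]].
have [c' ec' cb'] := cochain_lift p_surj eb'.
have edc' := diff_in_equivariant ec'.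
have [||a ea ac] := @kernel_cochain _ (c - diff_in c').
- exact: equivariantB.
- by rewrite cochain_map_zmod -diff_in_map cb' db' cb subrr.
apply/tate_eq0/(diff_in_succ _ (@equivariant G L)); exists a => //.
apply: (cochain_map_inj jI).
by rewrite -diff_out_map ac diff_out_zmod diff_out_in subr0.
Qed.

Hypothesis Cw : weakly_projective C.

Lemma connecting_surj i (y : tate L (int_succ i)) :
  exists x : tate B i, connecting x y.
Proof.
pose l := repr y; have /andP[el /eqP dl] := valP l.
have [c ec dc] : exists2 c, equivariant c &
    diff_out c = cochain_map j (val l) :> {ffun _.-tuple G -> C}.
  apply/(@diff_in_succ _ _ i _ (@equivariant G C)).
  apply: weakly_projective_acyclic => //.
    exact: cochain_map_equivariant.
  by rewrite diff_out_map dl raddf0.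
have cb : is_cocycle (cochain_map p c : {ffun (tate_width i).-tuple G -> B}).
  rewrite /is_cocycle cochain_map_equivariant //.
  by rewrite diff_out_map dc pj_cochain eqxx.
exists (\pi_(tate B i) (Sub _ cb)), c, (Sub _ cb), l.
by split; rewrite ?dc ?reprK.
Qed.

(** This gives injectivity: once [l] is the differential of [a], correcting [c] by the image of [a]
    yields a cocycle in [C], hence a coboundary, and [p] carries its primitive to one of [b]. *)
Lemma connecting_fun i (x : tate B i) : connecting x 0 -> x = 0.
Proof.
move=> [c [b [l [ec cb cl -> /esym/tate_eq0]]]].
move=> /(diff_in_succ _ (@equivariant G L))[a ea al].
have [||c' ec' dc'] := @weakly_projective_acyclic G C i (c - cochain_map j a)
  Cw.
- exact/equivariantB/cochain_map_equivariant.
- by rewrite diff_out_zmod diff_out_map al cl subrr.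
apply/tate_eq0; exists (cochain_map p c'); first exact: cochain_map_equivariant.
by rewrite diff_in_map dc' cochain_map_zmod pj_cochain subr0.
Qed.

End Connecting.

Lemma connecting_natural (G : finGroupType) (L C B L' C' B' : gmodType G)
    (j : {linear L -> C}) (p : {linear C -> B})
    (j' : {linear L' -> C'}) (p' : {linear C' -> B'})
    (uL : {linear L -> L'}) (uC : {linear C -> C'}) (uB : {linear B -> B'})
    i (x : tate B i) (y : tate L (int_succ i)) :
  (forall l, uC (j l) = j' (uL l)) -> (forall c, uB (p c) = p' (uC c)) ->
  connecting j p x y ->
  connecting j' p' (tate_map uB i x) (tate_map uL (int_succ i) y).
Proof.
move=> uj up [c [b [l [ec cb cl -> ->]]]].
exists (cochain_map uC c), (cocycle_map uB b), (cocycle_map uL l).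
rewrite !tate_map_pi; split=> //.
- exact: cochain_map_equivariant.
- by rewrite /= -cb; apply/ffunP => t; rewrite !ffunE up.
- by rewrite diff_out_map cl; apply/ffunP => t; rewrite !ffunE uj.
Qed.

(** * Natural isomorphisms *)

Record gfunctor (G : finGroupType) := GFunctor {
  fobj :> gmodType G -> zmodType;
  fmor : forall A B : gmodType G, {linear A -> B} -> fobj A -> fobj B
}.

Arguments fmor {G} g {A B} u x.

Definition natiso (G : finGroupType) (F F' : gfunctor G) : Prop :=
  exists phi : forall A : gmodType G, {additive F A -> F' A},
    (forall A, bijective (phi A)) /\
    (forall (A B : gmodType G) (u : {linear A -> B}) x,
       phi B (fmor F u x) = fmor F' u (phi A x)).

Section NatIso.
Variable G : finGroupType.
Implicit Types F : gfunctor G.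

Lemma natiso_of_rel F F' (R : forall A, F A -> F' A -> Prop) :
  (forall A x, exists y, R A x y) -> (forall A y, exists x, R A x y) ->
  (forall A x y x' y', R A x y -> R A x' y' -> R A (x - x') (y - y')) ->
  (forall A y, R A 0 y -> y = 0) -> (forall A x, R A x 0 -> x = 0) ->
  (forall (A B : gmodType G) (u : {linear A -> B}) x y,
     R A x y -> R B (fmor F u x) (fmor F' u y)) ->
  natiso F F'.
Proof.
move=> tot surj sub fun0 inj0 nat.
have ex A := cid (additive_of_rel (tot A) (@sub A) (@fun0 A)).
pose phi A := projT1 (ex A); have phiR A x : R A x (phi A x) := projT2 (ex A) x.
have phiE A x y : R A x y -> phi A x = y.
  by move=> /(sub _ _ _ _ _ (phiR A x)); rewrite subrr => /fun0/eqP;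
    rewrite subr_eq0 => /eqP.
exists phi; split=> [A|A B u x]; last exact/phiE/nat.
have [psi psiR] := choice (surj A); exists psi => [x|y]; last exact: phiE.
apply/eqP; rewrite -subr_eq0; apply/eqP/inj0.
by rewrite -(subrr (phi A x)); apply: sub.
Qed.

Lemma natiso_sym F F' : natiso F F' -> natiso F' F.
Proof.
move=> [phi [phib phiN]].
apply: (@natiso_of_rel _ _ (fun A x y => x = phi A y)).
- by move=> A x; have [psi _ K] := phib A; exists (psi x); rewrite K.
- by move=> A y; exists (phi A y).
- by move=> A x y x' y' -> ->; rewrite raddfB.
- by move=> A y y0; apply: (bij_inj (phib A)); rewrite -y0 raddf0.
- by move=> A x ->; rewrite raddf0.
- by move=> A B u x y ->; rewrite phiN.
Qed.

Lemma natiso_trans F F' F'' : natiso F F' -> natiso F' F'' -> natiso F F''.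
Proof.
move=> [phi [phib phiN]] [psi [psib psiN]].
exists (fun A => psi A \o phi A : {additive _ -> _}).
split=> [A|A B u x /=]; first exact: bij_comp.
by rewrite phiN psiN.
Qed.

(** One statement for all dimension shifts: the sequence depends functorially on [A], whether [A] is
    the coefficient module of Hom or is itself replaced by a syzygy or cosyzygy. *)
Lemma natiso_connecting (L C B : gmodType G -> gmodType G)
    (uL : forall A A' : gmodType G, {linear A -> A'} -> {linear L A -> L A'})
    (uC : forall A A' : gmodType G, {linear A -> A'} -> {linear C A -> C A'})
    (uB : forall A A' : gmodType G, {linear A -> A'} -> {linear B A -> B A'})
    (j : forall A, {linear L A -> C A}) (p : forall A, {linear C A -> B A}) i :
  (forall A, short_exact (j A) (p A)) -> (forall A, weakly_projective (C A)) ->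
  (forall (A A' : gmodType G) (u : {linear A -> A'}) l, uC A A' u (j A l) = j
    A' (uL A A' u l)) ->
  (forall (A A' : gmodType G) (u : {linear A -> A'}) c, uB A A' u (p A c) = p
    A' (uC A A' u c)) ->
  natiso (GFunctor (fun A A' u => tate_map (uB A A' u) i))
         (GFunctor (fun A A' u => tate_map (uL A A' u) (int_succ i))).
Proof.
move=> ex Cw uj up; set F := GFunctor _; set F' := (X in natiso F X).
apply: (@natiso_of_rel F F' (fun A => @connecting G _ _ _ (j A) (p A) i)).
- by move=> A x; apply: connecting_total.
- by move=> A y; apply: connecting_surj.
- by move=> A x y x' y'; apply: connecting_sub.
- by move=> A y; apply: connecting_inj.
- by move=> A x; apply: connecting_fun.
- by move=> A A' u x y; apply: connecting_natural (uj _ _ u) (up _ _ u).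
Qed.

End NatIso.

(** * Exact sequences of Hom groups *)

Section HomZComp.
Variables (G : finGroupType) (X Y : gmodType G) (v : {linear X -> Y}).
Variable A : gmodType G.

Definition homZ_comp (f : homZ Y A) : homZ X A := (f \o v : {additive X -> A}).

Lemma homZ_comp_is_linear : linear homZ_comp.
Proof.
apply: linear_of_gscale => [f g|s f]; apply: homZ_ext => x //=.
by rewrite !gscale_homZ /= linear_gscale.
Qed.

HB.instance Definition _ :=
  GRing.isLinear.Build _ _ _ _ homZ_comp homZ_comp_is_linear.

End HomZComp.

Section HomZExact.
Variable G : finGroupType.
Implicit Types X Y A L C B : gmodType G.

Lemma relnorm_homZ X A (t : homZ X A -> homZ X A) f x :
  relnorm t f x = \sum_(s : G)
    gscale s (t (gscale s^-1%g f) (gscale s^-1%g x)).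
Proof.
pose ev : homZ X A -> A := fun f => f x.
have [|e eE] := @exists_additive _ _ ev; first by [].
rewrite -[LHS]/(ev _) -eE raddf_sum; apply: eq_bigr => s _.
by rewrite eE /ev gscale_homZ.
Qed.

(** The norm of precomposition with [t] is precomposition with the norm of [t]. *)
Lemma homZ_weakly_projective_l X A :
  weakly_projective X -> weakly_projective (homZ X A).
Proof.
move=> [t tE].
have [|r rE] := @exists_additive (homZ X A) (homZ X A)
  (fun f => (f \o t : {additive X -> A})).
  by move=> f g; apply: homZ_ext.
exists r => f; apply: homZ_ext => x;
  rewrite relnorm_homZ -[in RHS](tE x) raddf_sum.
apply: eq_bigr => s _; rewrite rE gscale_homZ /= invgK -gscaleM mulgV gscale1.
by [].
Qed.

Lemma homZ_weakly_projective_r X A :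
  weakly_projective A -> weakly_projective (homZ X A).
Proof.
move=> [t tE].
have [|r rE] := @exists_additive (homZ X A) (homZ X A)
  (fun f => (t \o f : {additive X -> A})).
  by move=> f g; apply: homZ_ext => x /=; rewrite raddfB.
exists r => f; apply: homZ_ext => x; rewrite relnorm_homZ -[RHS]tE.
apply: eq_bigr => s _; rewrite rE gscale_homZ /= invgK -gscaleM mulgV gscale1.
by [].
Qed.

Lemma homZ_map_exact X L C B (j : {linear L -> C}) (p : {linear C -> B})
    (s : {additive B -> C}) :
  short_exact j p -> cancel s p ->
  short_exact (@homZ_map G X L C j) (@homZ_map G X C B p).
Proof.
move=> [jI pj psurj] sK; split.
- move=> f g fg; apply: homZ_ext => x; apply: jI.
  exact: (congr1 (fun h : homZ X C => h x) fg).
- move=> f; split=> [pf|[g <-]]; last first.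
    by apply: homZ_ext => x /=; apply/pj; exists (g x).
  have [|g gE] := @additive_factor _ _ _ j f jI; last first.
    by exists g; apply: homZ_ext => x; apply: gE.
  by move=> x; apply/pj; apply: (congr1 (fun h : homZ X B => h x) pf).
- move=> f; exists (s \o f : {additive X -> C}).
  by apply: homZ_ext => x /=; rewrite sK.
Qed.

(** An additive splitting is enough, since Hom is taken over the integers. *)
Lemma homZ_comp_exact X Y C A (j : {linear X -> C}) (p : {linear C -> Y})
    (s : {additive Y -> C}) :
  short_exact j p -> cancel s p ->
  short_exact (@homZ_comp G C Y p A) (@homZ_comp G X C j A).
Proof.
move=> jp sK; have [jI pj psurj] := jp; split.
- move=> f g fg; apply: homZ_ext => y; rewrite -(sK y).
  exact: (congr1 (fun h : homZ C A => h (s y)) fg).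
- move=> f; split=> [fj|[g <-]]; last first.
    by apply: homZ_ext => x /=; rewrite (pj (j x)).2 ?raddf0 //; exists x.
  exists (f \o s : {additive Y -> A}); apply: homZ_ext => x /=.
  apply/eqP; rewrite -subr_eq0 -raddfB; apply/eqP.
  have [y <-] : exists y, j y = s (p x) - x.
    by apply/pj; rewrite raddfB /= sK subrr.
  exact: (congr1 (fun h : homZ X A => h y) fj).
- move=> f; have [r rE] := short_exact_retraction jp sK.
  exists (f \o r : {additive C -> A}); apply: homZ_ext => x /=.
  have pjx : p (j x) = 0 by apply/pj; exists x.
  by congr (f _); apply: jI; rewrite rE /= pjx raddf0 subr0.
Qed.

End HomZExact.

(** * Dimension shifting *)

(** With these functors an encoding pair is, by conversion, a [natiso] in some degree. *)
Definition tateF (G : finGroupType) (X : gmodType G) (i : int) : gfunctor G :=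
  GFunctor (fun A B (u : {linear A -> B}) => tate_map (@homZ_map G X A B u) i).

Lemma natiso_contravariant (G : finGroupType) (X C Y : gmodType G)
    (j : {linear X -> C}) (p : {linear C -> Y}) (s : {additive Y -> C}) i :
  short_exact j p -> cancel s p -> weakly_projective C ->
  natiso (tateF X i) (tateF Y (int_succ i)).
Proof.
move=> jp sK Cw.
apply: (@natiso_connecting G (homZ Y) (homZ C) (homZ X)
  (@homZ_map G Y) (@homZ_map G C) (@homZ_map G X)
  (@homZ_comp G C Y p) (@homZ_comp G X C j) i).
- by move=> A; apply: homZ_comp_exact sK.
- by move=> A; apply: homZ_weakly_projective_l.
- by move=> A A' u f; apply: homZ_ext.
- by move=> A A' u f; apply: homZ_ext.
Qed.

Definition induced_mapl (G : finGroupType) (A B : zmodType)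
    (u : {additive A -> B}) : {linear induced G A -> induced G B} :=
  projT1 (cid (induced_map G u)).

Lemma induced_maplE (G : finGroupType) (A B : zmodType) (u : {additive A -> B})
  x t :
  induced_mapl G u x t = u (x t).
Proof. by rewrite /induced_mapl; case: cid. Qed.

Section Syzygy.
Variable G : finGroupType.
Implicit Types A B : gmodType G.

Definition syzygy A : gmodType G := submod (kernel_submod (induced_to A)).

Lemma syzygy_map_subproof A B (u : {linear A -> B}) x :
  x \in kernel_submod (induced_to A) -> induced_mapl G u x \in kernel_submod
    (induced_to B).
Proof.
move=> /kernel_submodP x0; apply/kernel_submodP;
  rewrite -[RHS](raddf0 u) -x0 !induced_toE.
rewrite raddf_sum; apply: eq_bigr => t _ /=.
by rewrite induced_maplE linear_gscale.
Qed.

Definition syzygy_map A B (u : {linear A -> B}) : {linear syzygy A -> syzygy B}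
  :=
  submod_map (syzygy_map_subproof u).

Lemma syzygy_exact A :
  short_exact (val : {linear syzygy A -> induced G A}) (induced_to A).
Proof.
have [s sK] := induced_to_section A.
split=> [|x|y]; [exact: val_inj| |by exists (s y)].
split=> [/kernel_submodP xk|[y <-]]; last exact/kernel_submodP/valP.
by exists (Sub x xk); apply: SubK.
Qed.

End Syzygy.

Section Cosyzygy.
Variable G : finGroupType.
Implicit Types A B : gmodType G.

Definition coinduced_of A : {linear A -> induced G A} :=
  projT1 (cid (induced_lift (idfun : {additive A -> A}))).

Lemma coinduced_ofE A x t : coinduced_of A x t = gscale t^-1%g x.
Proof. by rewrite /coinduced_of; case: cid => f /= ->. Qed.

(** The additive map sending [x] to [x - coinduced_of A (x 1%g)] kills exactly the image of
    [coinduced_of]. Frobenius reciprocity makes it equivariant, and the kernel stays the same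
    because that image is a submodule. *)
Lemma cosyzygy_proj_subproof A :
  exists f : {linear induced G A -> induced G (induced G A)},
    forall x t, f x t = gscale t^-1%g x - coinduced_of A (gscale t^-1%g x 1%g).
Proof.
have [|a aE] := @exists_additive (induced G A) (induced G A)
  (fun x => x - coinduced_of A (x 1%g)).
  by move=> x y; rewrite !ffunE raddfB !opprD !opprK addrACA.
by have [f fE] := induced_lift a; exists f => x t; rewrite fE aE.
Qed.

Definition cosyzygy_proj A : {linear induced G A -> induced G (induced G A)} :=
  projT1 (cid (cosyzygy_proj_subproof A)).

Lemma cosyzygy_projE A x t : cosyzygy_proj A x t =
  gscale t^-1%g x - coinduced_of A (gscale t^-1%g x 1%g).
Proof. by rewrite /cosyzygy_proj; case: cid => f /= ->. Qed.

(* The cokernel of coinduced_of, realized as an image. *)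
Definition cosyzygy A : gmodType G := submod (image_submod (cosyzygy_proj A)).

Lemma coinduced_of_map A B (u : {linear A -> B}) x :
  induced_mapl G u (coinduced_of A x) = coinduced_of B (u x).
Proof.
by apply/ffunP => t; rewrite induced_maplE !coinduced_ofE /= linear_gscale.
Qed.

Lemma cosyzygy_proj_map A B (u : {linear A -> B}) x :
  induced_mapl G (induced_mapl G u) (cosyzygy_proj A x) =
  cosyzygy_proj B (induced_mapl G u x).
Proof.
apply/ffunP => t; rewrite induced_maplE !cosyzygy_projE raddfB /=.
by rewrite coinduced_of_map -linear_gscale induced_maplE.
Qed.

Lemma cosyzygy_map_subproof A B (u : {linear A -> B}) y :
  y \in image_submod (cosyzygy_proj A) ->
  induced_mapl G (induced_mapl G u) y \in image_submod (cosyzygy_proj B).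
Proof.
move=> /image_submodP[x <-]; apply/image_submodP; exists (induced_mapl G u x).
by rewrite cosyzygy_proj_map.
Qed.

Definition cosyzygy_map A B (u : {linear A -> B}) :
    {linear cosyzygy A -> cosyzygy B} :=
  submod_map (cosyzygy_map_subproof u).

Lemma cosyzygy_to_subproof A x : cosyzygy_proj A x \in image_submod
  (cosyzygy_proj A).
Proof. by apply/image_submodP; exists x. Qed.

Definition cosyzygy_to A : {linear induced G A -> cosyzygy A} :=
  projT1 (cid (submod_lift (@cosyzygy_to_subproof A))).

Lemma cosyzygy_toE A x : val (cosyzygy_to A x) = cosyzygy_proj A x.
Proof. by rewrite /cosyzygy_to; case: cid => f /= ->. Qed.

(** Evaluation at 1 is an additive section: it returns a preimage of [y] changed by an element of
    the image of [coinduced_of]. *)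
Lemma cosyzygy_to_section A :
  exists s : {additive cosyzygy A -> induced G A}, cancel s (cosyzygy_to A).
Proof.
have [|s sE] := @exists_additive (cosyzygy A) (induced G A) (fun y => val y
  1%g).
  by move=> x y; rewrite raddfB !ffunE.
exists s => y; apply: val_inj; rewrite cosyzygy_toE sE.
have /image_submodP[x <-] := valP y.
have at1 (u v : induced G A) : (u - v) 1%g = u 1%g - v 1%g by rewrite !ffunE.
apply/ffunP => t; rewrite !cosyzygy_projE invg1 gscale1 raddfB /=.
rewrite -linear_gscale at1 coinduced_ofE invg1 gscale1 raddfB /=.
by rewrite opprB addrA subrK.
Qed.

Lemma cosyzygy_exact A : short_exact (coinduced_of A) (cosyzygy_to A).
Proof.
have [s sK] := cosyzygy_to_section A.
split=> [x y /ffunP/(_ 1%g)|x|y]; last by exists (s y).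
  by rewrite !coinduced_ofE invg1 !gscale1.
split=> [/(congr1 \val)|[y <-]].
  rewrite cosyzygy_toE => /ffunP/(_ 1%g).
  rewrite cosyzygy_projE invg1 gscale1 ffunE => /eqP.
  by rewrite subr_eq0 => /eqP ->; eexists.
apply: val_inj; rewrite cosyzygy_toE; apply/ffunP => t.
rewrite cosyzygy_projE -linear_gscale coinduced_ofE invg1 gscale1 subrr.
by rewrite ffunE.
Qed.

End Cosyzygy.

Section Shift.
Variables (G : finGroupType) (X Y : gmodType G).

Lemma natiso_pred i j :
  natiso (tateF X (int_succ i)) (tateF Y (int_succ j)) ->
  natiso (tateF X i) (tateF Y j).
Proof.
pose F Z k : gfunctor G :=
  GFunctor (fun A B u => fmor (tateF Z k) (@syzygy_map G A B u)).
have shift Z k : natiso (tateF Z k) (F Z (int_succ k)).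
  apply: (@natiso_connecting G (fun A => homZ Z (syzygy A))
    (fun A => homZ Z (induced G A)) (homZ Z)
    (fun A B u => homZ_map (syzygy_map u))
    (fun A B u => homZ_map (induced_mapl G u)) (fun A B u => homZ_map u)
    (fun A => homZ_map (val : {linear syzygy A -> induced G A}))
    (fun A => homZ_map (induced_to A)) k).
  - move=> A; have [s sK] := induced_to_section A.
    by apply: homZ_map_exact sK; apply: syzygy_exact.
  - by move=> A; apply/homZ_weakly_projective_r/induced_weakly_projective.
  - by move=> A B u f; apply: homZ_ext => x /=; rewrite submod_mapE.
  - move=> A B u f; apply: homZ_ext => x /=; rewrite !induced_toE raddf_sum.
    by apply: eq_bigr => t _; rewrite /= induced_maplE linear_gscale.
move=> [phi [phib phiN]]; apply: natiso_trans (shift X i) _.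
apply: natiso_trans (natiso_sym (shift Y j)).
by exists (fun A => phi (syzygy A)); split=> [A|A B u];
  [exact: phib|exact: phiN].
Qed.

Lemma natiso_succ i j :
  natiso (tateF X i) (tateF Y j) ->
  natiso (tateF X (int_succ i)) (tateF Y (int_succ j)).
Proof.
pose F Z k : gfunctor G :=
  GFunctor (fun A B u => fmor (tateF Z k) (@cosyzygy_map G A B u)).
have shift Z k : natiso (F Z k) (tateF Z (int_succ k)).
  apply: (@natiso_connecting G (homZ Z)
    (fun A => homZ Z (induced G A)) (fun A => homZ Z (cosyzygy A))
    (fun A B u => homZ_map u)
    (fun A B u => homZ_map (induced_mapl G u))
    (fun A B u => homZ_map (cosyzygy_map u))
    (fun A => homZ_map (coinduced_of A))
    (fun A => homZ_map (cosyzygy_to A)) k).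
  - move=> A; have [s sK] := cosyzygy_to_section A.
    by apply: homZ_map_exact sK; apply: cosyzygy_exact.
  - by move=> A; apply/homZ_weakly_projective_r/induced_weakly_projective.
  - by move=> A B u f; apply: homZ_ext => x /=; rewrite coinduced_of_map.
  - move=> A B u f; apply: homZ_ext => x /=; apply: val_inj.
    by rewrite submod_mapE !cosyzygy_toE cosyzygy_proj_map.
move=> [phi [phib phiN]]; apply: natiso_trans (natiso_sym (shift X i)) _.
apply: natiso_trans (shift Y j).
by exists (fun A => phi (cosyzygy A)); split=> [A|A B u];
  [exact: phib|exact: phiN].
Qed.

Lemma natiso_degree0 (i r : int) :
  natiso (tateF X i) (tateF Y (i + r)) -> natiso (tateF X 0) (tateF Y r).
Proof.
elim/int_ind: i => [|n IHn|n IHn]; first by rewrite add0r.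
  rewrite -addn1 PoszD -addrA [1 + r]addrC addrA -!int_succE.
  by move=> /natiso_pred.
move=> /natiso_succ; rewrite !int_succE => XY; apply: IHn.
have -> : - n%:Z = - n.+1%:Z + 1 by lia.
by rewrite addrAC.
Qed.

End Shift.

(** * Degree zero: stable homomorphisms *)

Section DegreeZero.
Variables (G : finGroupType) (X A : gmodType G).

Lemma gscale_linear s (f : {linear X -> A}) :
  gscale s (f : homZ X A) = (f : homZ X A).
Proof.
apply: homZ_ext => x; rewrite gscale_homZ /=.
by rewrite linear_gscale -gscaleM mulgV gscale1.
Qed.

(** An equivariant map is a G-invariant of Hom, so the constant function at it is an equivariant
    cochain of width 1, that is, of degree 0. *)
Definition stable_cochain (f : {linear X -> A}) : {ffun 1.-tuple G -> homZ X A}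
  :=
  [ffun=> f : homZ X A].

Lemma stable_cocycle f : @is_cocycle G (homZ X A) 0 (stable_cochain f).
Proof.
apply/andP; split; first by apply/equivariantP => s t;
  rewrite !ffunE gscale_linear.
apply/eqP/ffunP => t; rewrite !ffunE !big_ord_recl big_ord0 !ffunE.
by rewrite expr0 expr1 mulr1z mulrNz mulr1z addr0 subrr.
Qed.

Definition stable_class f : tate (homZ X A) 0 :=
  \pi_(tate (homZ X A) 0) (Sub (stable_cochain f) (stable_cocycle f)).

Lemma eq_stable_class (f g : {linear X -> A}) : f =1 g -> stable_class f =
  stable_class g.
Proof.
move=> fg; congr (\pi_(tate (homZ X A) 0) _); apply: val_inj.
by apply/ffunP => t; rewrite !SubK !ffunE; apply: homZ_ext.
Qed.

(** The cocycle condition forces a cochain of width 1 to be constant, and equivariance then makes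
    its value a G-map. *)
Lemma stable_class_surj z : exists f, stable_class f = z.
Proof.
pose c := repr z; have /andP[/equivariantP ec /eqP/ffunP dc] := valP c.
have cst t : val c t = val c [tuple 1%g].
  case/tupleP: t => x t; have := dc [tuple of x :: [tuple 1%g]].
  rewrite /= face_sum_cons face_sum0 !ffunE => /eqP;
    rewrite subr_eq0 => /eqP ->.
  by rewrite [t]tuple0; congr (val c _); apply: val_inj.
have [|f fE] := @exists_linear _ X A (val c [tuple 1%g] : homZ X A).
  apply: linear_of_gscale => [x y|s x]; first exact: raddfB.
  rewrite -[in LHS](cst [tuple of map (mulg s) [tuple 1%g]]) ec gscale_homZ /=.
  by rewrite -gscaleM mulVg gscale1.
exists f; rewrite -[z]reprK; congr (\pi_(tate (homZ X A) 0) _).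
apply: val_inj; apply/ffunP => t; rewrite SubK ffunE [RHS]cst.
exact: homZ_ext.
Qed.

(** A coboundary in degree 0 sums [c] over one-element tuples; by equivariance this is the norm of
    the value at 1. *)
Lemma stable_class_eq f g : stable_class f = stable_class g ->
  exists a : {additive X -> A}, forall x, f x - g x = relnorm a x.
Proof.
move=> /eqP; rewrite -subr_eq0 -raddfB => /eqP/tate_eq0[c /equivariantP ec dc].
exists (c [tuple 1%g] : homZ X A) => x.
pose ev : homZ X A -> A := fun h => h x.
have [|e eE] := @exists_additive _ _ ev; first by [].
have /ffunP/(_ [tuple 1%g]) := dc; rewrite raddfB !ffunE => cfg.
transitivity (ev (\sum_(s : G) c [tuple s])); first by rewrite cfg.
rewrite -eE raddf_sum; apply: eq_bigr => s _.
have -> : [tuple s] = [tuple of map (mulg s) [tuple 1%g]].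
  by apply: val_inj; rewrite /= mulg1.
by rewrite ec gscale_homZ eE.
Qed.

End DegreeZero.

Lemma stable_class_map (G : finGroupType) (X A B : gmodType G)
    (u : {linear A -> B}) (f : {linear X -> A}) :
  tate_map (@homZ_map G X A B u) 0 (stable_class f) =
  stable_class (u \o f : {linear X -> B}).
Proof.
rewrite tate_map_pi; congr (\pi_(tate (homZ X B) 0) _).
by apply: val_inj; apply/ffunP => t; rewrite !ffunE; apply: homZ_ext.
Qed.

(* Yoneda: the images of the classes of the identities are mutually inverse
   stable homomorphisms. *)
Lemma natiso_stable_equivalence (G : finGroupType) (X Y : gmodType G) :
  natiso (tateF X 0) (tateF Y 0) ->
  exists (f : {linear X -> Y}) (g : {linear Y -> X})
    (a : {additive X -> X}) (b : {additive Y -> Y}),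
    (forall x, x - g (f x) = relnorm a x) /\
    (forall y, y - f (g y) = relnorm b y).
Proof.
move=> [phi [phib phiN]].
have [g gE] := stable_class_surj (phi X (stable_class (idfun : {linear X ->
  X}))).
have [psi psiK phiK] := phib Y.
have [f fE] := stable_class_surj (psi (stable_class (idfun : {linear Y -> Y}))).
have phif : phi Y (stable_class f) = stable_class (idfun : {linear Y -> Y}).
  by rewrite fE phiK.
exists f, g.
have [a aE] : exists a : {additive X -> X}, forall x, x - g (f x) = relnorm a x.
  apply: (@stable_class_eq G X X idfun (g \o f : {linear X -> X})).
  (* By naturality [phi] sends the class of [g \o f] to the image under [g] of the class of the
     identity of [Y], which is the class of [g], and so the image of the class of the identity of
     [X]. *)
  apply: (bij_inj (phib X)).
  rewrite -(stable_class_map g f) -gE -[RHS]/(phi X (fmor (tateF X 0) g _)).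
  by rewrite phiN phif /= stable_class_map; apply: eq_stable_class.
have [b bE] : exists b : {additive Y -> Y}, forall y, y - f (g y) = relnorm b y.
  apply: (@stable_class_eq G Y Y idfun (f \o g : {linear Y -> Y})).
  rewrite -phif -(stable_class_map f g) gE -[RHS]/(fmor (tateF Y 0) f _) -phiN
    /=.
  by rewrite stable_class_map; congr (phi Y _); apply: eq_stable_class.
by exists a, b.
Qed.

(** * Replacing the kernel of a projective cover up to stable equivalence *)

Section Replace.
Variables (G : finGroupType) (X Y F K : gmodType G).
Variables (j : {linear Y -> F}) (p : {linear F -> K}) (s : {additive K -> F}).
Hypotheses (jp : short_exact j p) (sK : cancel s p).
Hypotheses (X_Zproj : Zprojective X) (F_proj : projective F).
Variables (f : {linear X -> Y}) (g : {linear Y -> X}).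
Variables (a : {additive X -> X}) (b : {additive Y -> Y}).
Hypotheses (aE : forall x, x - g (f x) = relnorm a x).
Hypotheses (bE : forall y, y - f (g y) = relnorm b y).

(* X is the direct summand of Y + Ind X cut out by the idempotent 1 - e, and e
   is a norm, so that composing e with an additive retraction of
   J : Y + Ind X -> F + Ind X and taking the norm extends e to an equivariant
   map rho on F + Ind X. The new middle term is the kernel of rho. *)
Lemma stable_replacement :
  exists (P : gmodType G) (j' : {linear X -> P}) (p' : {linear P -> K}),
    projective P /\ short_exact j' p'.
Proof.
have [jI pj psurj] := jp.
pose E : gmodType G := induced G X.
pose Z : gmodType G := (Y * E)%type; pose D : gmodType G := (F * E)%type.
pose q : {linear E -> X} := induced_to X.
(* Since [q \o i] is the norm of [a], the map [(f, i)] from [X] to [Z] is split by [g + q]. *)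
have [i iE] := induced_lift a.
have qi x : q (i x) = x - g (f x).
  by rewrite /q induced_toE aE; apply: eq_bigr => t _; rewrite iE.
have [t tE] : weakly_projective E by apply: induced_weakly_projective.
have [io ioE] : exists h : {linear X -> Z}, h =1 (fun x => (f x, i x)).
  by apply: exists_linear => c x y; rewrite !linearP.
have [pr prE] : exists h : {linear Z -> X}, h =1 (fun z => g z.1 + q z.2).
  apply: exists_linear => c x y; rewrite /= !linearP scalerDr.
  exact: addrACA.
have prK x : pr (io x) = x by rewrite prE ioE /= qi addrCA subrr addr0.
have [e eE] : exists h : {linear Z -> Z}, h =1 (fun z => z - io (pr z)).
  apply: exists_linear => c x y.
  rewrite (linearP pr) (linearP io) scalerBr opprD.
  exact: addrACA.
have pre z : pr (e z) = 0 by rewrite eE raddfB /= prK subrr.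
have eK z : e (e z) = e z by rewrite [LHS]eE pre raddf0 subr0.
(* An additive map of norm [e]: [1 - f g] is the norm of [b], and the remaining terms pass through
   [E], where [t] has norm 1. *)
have [th thE] : exists h : {additive Z -> Z},
    h =1 (fun z => (b z.1 - f (q (t z.2)), t (z.2 - i (pr z)))).
  apply: exists_additive => x y; congr (_, _);
    by rewrite !raddfB /= !opprK addrACA opprD opprK.
have the z : relnorm th z = e z.
  rewrite eE ioE (eq_relnorm thE); apply: injective_projections.
    rewrite [LHS](raddf_sum fst) /=.
    transitivity (relnorm b z.1 - f (q (relnorm t z.2))).
      rewrite -[f _]/((f \o q) _) -relnorm_comp_l -sumrB.
      by apply: eq_bigr => r _; rewrite -raddfB.
    by rewrite -bE tE prE raddfD opprD addrA.
  rewrite [LHS](raddf_sum snd) /= -[RHS]tE; apply: eq_bigr => r _ /=.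
  by rewrite (linear_gscale pr) (linear_gscale i) /gscale scalerBr.
have [J JE] : exists h : {linear Z -> D}, h =1 (fun z => (j z.1, z.2)).
  by apply: exists_linear => c x y; rewrite !linearP.
have [r rE] := short_exact_retraction jp sK.
have pjx y : p (j y) = 0 by apply/pj; exists y.
have [R RE] : exists h : {additive D -> Z}, h =1 (fun d => (r d.1, d.2)).
  by apply: exists_additive => x y; congr (_, _); rewrite raddfB.
have RJ z : R (J z) = z.
  rewrite RE JE /= [RHS]surjective_pairing; congr (_, _).
  by apply: jI; rewrite rE pjx raddf0 subr0.
have [rh rhE] := relnorm_linear (th \o R : {additive D -> Z}).
(* The extra factor [e] puts the values of [rho] in the image of [e], whence
   [rho \o J \o rho = rho], and [1 - J rho] retracts [D] onto the kernel of [rho]. *)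
have [rho rhoE] : exists h : {linear D -> Z}, forall d, h d = e (rh d).
  by exists (e \o rh).
have rhoJ z : rho (J z) = e z.
  rewrite rhoE -[RHS]eK; congr (e _); rewrite rhE -(relnorm_comp_r _ J) -the.
  by apply: eq_relnorm => y /=; rewrite RJ.
pose P : gmodType G := submod (kernel_submod rho).
have [ret retE] : exists h : {linear D -> P}, forall d, val (h d) = d - J (rho
  d).
  have [h0 h0E] : exists h : {linear D -> D}, h =1 (fun d => d - J (rho d)).
    apply: exists_linear => c x y.
    rewrite (linearP rho) (linearP J) scalerBr opprD.
    exact: addrACA.
  have [|h hE] := @submod_lift _ _ (kernel_submod rho) _ h0.
    by move=> d; apply/kernel_submodP; rewrite h0E raddfB /= rhoJ rhoE eK subrr.
  by exists h => d; rewrite hE h0E.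
have retK : cancel (val : {linear P -> D}) ret.
  move=> d; apply: val_inj; rewrite retE.
  by have /kernel_submodP -> := valP d; rewrite raddf0 subr0.
have [|j' j'E] := @submod_lift _ _ (kernel_submod rho) _ (J \o io : {linear X
  -> D}).
  by move=> x; apply/kernel_submodP; rewrite /= rhoJ eE prK subrr.
pose p' : {linear P -> K} := p \o fst \o (val : {linear P -> D}).
exists P, j', p'; split.
  apply: projective_of_Zprojective.
    apply: (Zprojective_retract retK); apply: Zprojective_prod.
      exact: projective_Zprojective.
    exact: Zprojective_ffun.
  apply: (weakly_projective_retract retK); apply: weakly_projective_prod.
    exact: projective_weakly_projective.
  exact: induced_weakly_projective.
split=> [x y /(congr1 \val)|d|k].
- rewrite !j'E /= => /(congr1 (pr \o R)) /=.
  by rewrite !RJ !prK.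
- split=> [|[x <-]]; last by rewrite /p' /= j'E /= JE pjx.
  (* If [p'] kills [d], then [d] is [J z] for some [z]. As [rho (J z) = e z] vanishes, [z] lies in
     the summand [X]. *)
  rewrite /p' /= => /pj[y yE]; exists (pr (y, (val d).2)).
  have dE : val d = J (y, (val d).2) by rewrite JE /= yE -surjective_pairing.
  apply: val_inj; rewrite j'E /= [RHS]dE; congr (J _).
  have /kernel_submodP := valP d; rewrite dE rhoJ eE -dE => /eqP.
  by rewrite subr_eq0 => /eqP <-.
(* Retracting to [P] subtracts an element of the image of [J], whose first component is killed by
   [p]. *)
- exists (ret (s k, 0)); rewrite /p' /= retE /= JE.
  by rewrite raddfB /= pjx subr0 sK.
Qed.

End Replace.

(** * Exact sequences of projectives *)

Section Sequences.
Variables (G : finGroupType) (X' : gmodType G).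
Hypothesis X'_Zproj : Zprojective X'.

Lemma natiso_refl (F : gfunctor G) : natiso F F.
Proof. by exists (fun A => idfun); split=> // A; exists idfun. Qed.

(** [K] is the cokernel of [f], realized as [X'] or as a kernel inside the next projective. Each
    projective passed raises the degree by one. *)
Lemma exact_tail_natiso n (L M : gmodType G) (f : {linear L -> M}) :
  exact_tail X' n f ->
  exists (K : gmodType G) (q : {linear M -> K}),
    [/\ Zprojective K, forall x, q x = 0 <-> exists y, f y = x,
        forall z, exists x, q x = z &
        forall i, natiso (tateF K i) (tateF X' (i + n%:Z))].
Proof.
elim: n L M f => [|n IHn] L M f /=.
  move=> [g [gf gsurj]]; exists X', g; split=> // i.
  by rewrite addr0; apply: natiso_refl.
move=> [P [g [Pproj gf /IHn[K [q [Kproj qg qsurj Kiso]]]]]].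
have [|h hE] := @submod_lift _ _ (kernel_submod q) _ g.
  by move=> x; apply/kernel_submodP/qg; exists x.
have [t tK] := Zprojective_section Kproj qsurj.
have ex : short_exact (val : {linear submod (kernel_submod q) -> P}) q.
  split=> [|x|//]; first exact: val_inj.
  split=> [/kernel_submodP xk|[y <-]]; last exact/kernel_submodP/valP.
  by exists (Sub x xk); apply: SubK.
exists (submod (kernel_submod q)), h; split.
- exact: short_exact_Zprojective ex tK (projective_Zprojective Pproj).
- move=> x; rewrite -gf -hE; split=> [->|hx]; first by rewrite raddf0.
  by apply: val_inj; rewrite hx raddf0.
- move=> z; have /kernel_submodP/qg[x xE] := valP z; exists x.
  by apply: val_inj; rewrite hE.
- move=> i; rewrite -addn1 addnC PoszD addrA -int_succE.
  apply: natiso_trans (Kiso _).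
  exact: (natiso_contravariant i ex tK (projective_weakly_projective Pproj)).
Qed.

(** [K] is an iterated syzygy of [X'], fixed before [L], [M] and [f], so that any sequence ending in
    a surjection onto it can be spliced with the resolution. *)
Lemma exact_tail_resolution n : exists K : gmodType G,
  [/\ Zprojective K, forall i, natiso (tateF K i) (tateF X' (i + n%:Z)) &
      forall (L M : gmodType G) (f : {linear L -> M}) (q : {linear M -> K}),
        (forall x, q x = 0 <-> exists y, f y = x) ->
        (forall z, exists x, q x = z) -> exact_tail X' n f].
Proof.
elim: n => [|n [K [Kproj Kiso Ktail]]].
  exists X'; split=> // [i|L M f q qf qsurj]; last by exists q.
  by rewrite addr0; apply: natiso_refl.
have [t tK] := induced_to_section K; have ex := syzygy_exact K.
exists (syzygy K); split.
- by apply: short_exact_Zprojective ex tK _; apply: Zprojective_ffun.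
- move=> i; rewrite -addn1 addnC PoszD addrA -int_succE.
  apply: natiso_trans (Kiso _).
  exact: (natiso_contravariant i ex tK (@induced_weakly_projective G K)).
- move=> L M f q qf qsurj.
  exists (induced G K), (val \o q : {linear M -> induced G K}); split.
  + exact: induced_projective.
  + move=> x; rewrite -qf; split=> [qx|/= ->] //.
    by apply: val_inj.
  + apply: (Ktail _ _ _ (induced_to K)) => [x|z]; last by exists (t z);
    apply: tK.
    split=> [/kernel_submodP xk|[y <-]]; last exact/kernel_submodP/valP.
    have [y yE] := qsurj (Sub x xk); exists y.
    exact: (congr1 \val yE).
Qed.

End Sequences.

(** * Encoding pairs and exact sequences of projectives *)

Theorem theorem1p5 (G : finGroupType) (X X' : gmodType G) (r : nat)
  (X_free : Zfree X) (X'_free : Zfree X') (r_gt0 : (0 < r)%N) :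
  encoding_pair (Posz r) X X' <-> projective_exact_sequence r X X'.
Proof.
have Xproj := Zfree_Zprojective X_free.
have X'proj := Zfree_Zprojective X'_free.
case: r r_gt0 => // r _; split.
- move=> [i iso].
  have /natiso_degree0 XX' : natiso (tateF X i) (tateF X' (i + r.+1%:Z)) := iso.
  (* Here [r] is one less than the number of projectives. The resolution stops one step early, since
     the projective over [K] is the one to be modified so that its kernel becomes [X]. *)
  have [K [Kproj Kiso Ktail]] := exact_tail_resolution X'proj r.
  have [s sK] := induced_to_section K.
  have YK := natiso_contravariant 0 (syzygy_exact K) sK
    (@induced_weakly_projective G K).
  have XY : natiso (tateF X 0) (tateF (syzygy K) 0).
    apply: natiso_trans XX' (natiso_sym (natiso_trans YK _)).
    by rewrite -addn1 addnC PoszD.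
  have [f [g [a [b [aE bE]]]]] := natiso_stable_equivalence XY.
  have [P [j [p [Pproj [jI pj psurj]]]]] := stable_replacement
    (syzygy_exact K) sK Xproj (induced_projective Kproj) aE bE.
  exists P, j; split=> //; last exact: Ktail psurj.
  move=> x; split=> [jx|[y <-]]; last by rewrite raddf0.
  by exists 0; apply: jI; rewrite jx raddf0.
- move=> [P [g [Pproj gf /(exact_tail_natiso X'proj)[K [q [Kproj qg qsurj
  Kiso]]]]]].
  have [s sK] := Zprojective_section Kproj qsurj.
  (* Exactness after the zero map is injectivity of [g], so the sequence breaks off as [X], [P] and
     the cokernel [K]. *)
  have ex : short_exact g q.
    split=> // x y gxy; apply/eqP; rewrite -subr_eq0; apply/eqP.
    by have /gf[z <-] : g (x - y) = 0 by rewrite raddfB /= gxy subrr.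
  suff : natiso (tateF X 0) (tateF X' (0 + r.+1%:Z)) by move=> iso; exists 0.
  apply: natiso_trans (natiso_contravariant 0 ex sK
    (projective_weakly_projective Pproj)) _.
  by rewrite -addn1 addnC PoszD addrA; apply: Kiso.
Qed.
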